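(* Suppose that the error estimator satisfies stability on non-refined element domains, reduction on refined element domains, reliability, and discrete reliability, and that $b(\cdot,\cdot)$ is definite on $\mathcal X_\infty$ (all as defined in the context), and let $0<\theta\le1$. Then there exist constants $C_\ell\ge1$ with $\lim_{\ell\to\infty}C_\ell=1$ and an index $\ell_4>0$ such that the output of the adaptive algorithm satisfies $$\|u-U_\ell\|_a\le C_\ell\,\min_{V_\ell\in\mathcal X_\ell}\|u-V_\ell\|_a\quad\text{for all }\ell\ge\ell_4.$$
   Context: Problem. Let $\mathbb K\in\{\mathbb R,\mathbb C\}$ and let $\mathcal H$ be a separable Hilbert space over $\mathbb K$ with norm $\|\cdot\|_{\mathcal H}$, dual space $\mathcal H^*$ and duality pairing $\langle\cdot,\cdot\rangle$ on $\mathcal H^*\times\mathcal H$ (antilinear in the second argument if $\mathbb K=\mathbb C$). Let $a(\cdot,\cdot)$ be a hermitian, continuous sesquilinear form on $\mathcal H$ that is elliptic: there is $\alpha>0$ with $\alpha\|v\|_{\mathcal H}^2\le a(v,v)$ for all $v\in\mathcal H$; write $\|v\|_a:=a(v,v)^{1/2}$. Let $\mathcal K:\mathcal H\to\mathcal H^*$ be a compact linear operator, $f\in\mathcal H^*$, and $b(w,v):=a(w,v)+\langle\mathcal Kw,v\rangle$. The problem $b(u,v)=\langle f,v\rangle$ for all $v\in\mathcal H$ is assumed to be well-posed, i.e., for $w\in\mathcal H$: $w=0$ if and only if $b(w,v)=0$ for all $v\in\mathcal H$; $u\in\mathcal H$ denotes its unique solution. For a finite-dimensional subspace $\mathcal X_\bullet\subset\mathcal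 H$, the discrete problem is: find $U_\bullet\in\mathcal X_\bullet$ with $b(U_\bullet,V_\bullet)=\langle f,V_\bullet\rangle$ for all $V_\bullet\in\mathcal X_\bullet$. It may fail to have a unique solution; ''$U_\bullet$ exists'' means that a unique solution exists. The inf-sup constant of $\mathcal X_\bullet$ is $\gamma_\bullet:=\inf_{W\in\mathcal X_\bullet\setminus\{0\}}\sup_{V\in\mathcal X_\bullet\setminus\{0\}}\frac{|b(W,V)|}{\|W\|_{\mathcal H}\|V\|_{\mathcal H}}$. Meshes. $\Omega\subset\mathbb R^d$ ($d\ge2$) is a polygonal/polyhedral Lipschitz domain; $\mathcal T_0$ is a given conforming initial triangulation; the local mesh-size of $\mathcal T_\bullet$ is $h_\bullet|_T:=|T|^{1/d}$. A fixed refinement strategy (e.g. newest vertex bisection) is given: for a conforming triangulation $\mathcal T_\star$ and $\mathcal M_\star\subseteq\mathcal T_\star$, $\mathcal T_\bullet={\rm refine}(\mathcal T_\star,\mathcal M_\star)$ is the coarsest (minimal number of elements) conforming triangulation such that every $T\in\mathcal T_\star$ is the union of the elements of $\mathcal T_\bullet$ contained in it and $\mathcal M_\star\subseteq\mathcal T_\star\setminus\mathcal T_\bullet$. $\mathcal T_\bullet\in{\rm refine}(\mathcal T_\star)$ means $\mathcal T_\bullet$ is obtained from $\mathcal T_\star$ by finitely many (possibly zero) such steps, and $\mathbb T:={\rm refine}(\mathcal T_0)$. There is $0<q_{\rm mesh}<1$ such that $\mathcal T_\bullet\in{\rm refine}(\mathcal T_\star)$ implies $h_\bullet|_T\le q_{\rm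 mesh}h_\star|_T$ for all $T\in\mathcal T_\star\setminus\mathcal T_\bullet$. Each $\mathcal T_\star\in\mathbb T$ has an associated finite-dimensional subspace $\mathcal X_\star\subset\mathcal H$, and $\mathcal T_\bullet\in{\rm refine}(\mathcal T_\star)$ implies $\mathcal X_\star\subseteq\mathcal X_\bullet$. Uniform refinement means marking all elements; for every sequence $\widehat{\mathcal T}_0=\mathcal T_0$, $\widehat{\mathcal T}_{\ell+1}={\rm refine}(\widehat{\mathcal T}_\ell,\widehat{\mathcal M}_\ell)$ with $\widehat{\mathcal M}_\ell=\widehat{\mathcal T}_\ell$ for infinitely many $\ell$, $\bigcup_\ell\widehat{\mathcal X}_\ell$ is dense in $\mathcal H$. Estimator. Whenever $\mathcal T_\star\in\mathbb T$ and $U_\star$ exists, refinement indicators $\eta_\star(T)\ge0$, $T\in\mathcal T_\star$, are given; $\eta_\star(\mathcal U):=(\sum_{T\in\mathcal U}\eta_\star(T)^2)^{1/2}$ for $\mathcal U\subseteq\mathcal T_\star$ and $\eta_\star:=\eta_\star(\mathcal T_\star)$. Adaptive algorithm. Input: $0<\theta\le1$, $C_{\rm mark}\ge1$, $\mathcal T_0$, $U_{-1}:=0$, $\eta_{-1}:=1$. For $\ell=0,1,2,\dots$: if the discrete problem has no unique solution in $\mathcal X_\ell$, set $U_\ell:=U_{\ell-1}$, $\eta_\ell:=\eta_{\ell-1}$, $\mathcal T_{\ell+1}:={\rm refine}(\mathcal T_\ell,\mathcal T_\ell)$ and go to the next $\ell$. Otherwise compute the unique solution $U_\ell\in\mathcal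 X_\ell$ and the indicators $\eta_\ell(T)$, determine $\mathcal M_\ell\subseteq\mathcal T_\ell$ of (up to the multiplicative constant $C_{\rm mark}$) minimal cardinality such that $\theta\eta_\ell^2\le\eta_\ell(\mathcal M_\ell)^2$ (Dörfler marking), and set $\mathcal T_{\ell+1}:={\rm refine}(\mathcal T_\ell,\mathcal M_\ell)$. The output is the sequences $\mathcal T_\ell,U_\ell,\eta_\ell$; $\mathcal X_\infty:=\overline{\bigcup_{\ell\ge0}\mathcal X_\ell}$. Assumptions named in the claim. Stability: there is $C_{\rm stb}>0$ such that for all $\mathcal T_\star\in\mathbb T$, $\mathcal T_\bullet\in{\rm refine}(\mathcal T_\star)$ for which $U_\star,U_\bullet$ exist, $|\eta_\bullet(\mathcal T_\bullet\cap\mathcal T_\star)-\eta_\star(\mathcal T_\bullet\cap\mathcal T_\star)|\le C_{\rm stb}\|U_\bullet-U_\star\|_{\mathcal H}$. Reduction: there are $C_{\rm red}>0$, $0<q_{\rm red}<1$ such that for all such $\mathcal T_\star,\mathcal T_\bullet$, $\eta_\bullet(\mathcal T_\bullet\setminus\mathcal T_\star)^2\le q_{\rm red}\eta_\star(\mathcal T_\star\setminus\mathcal T_\bullet)^2+C_{\rm red}^2\|U_\bullet-U_\star\|_{\mathcal H}^2$. Reliability: there is $C_{\rm rel}'>0$ such that $\|u-U_\star\|_{\mathcal H}\le C_{\rm rel}'\eta_\star$ for all $\mathcal T_\star\in\mathbb T$ for which $U_\star$ exists. Discrete reliability: there is $C_{\rm rel}>0$ such that for all $\mathcal T_\star\in\mathbb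 T$ and $\mathcal T_\bullet\in{\rm refine}(\mathcal T_\star)$ there is a set $\mathcal R_{\star,\bullet}\subseteq\mathcal T_\star$ such that, if $U_\star,U_\bullet$ exist, $\|U_\bullet-U_\star\|_{\mathcal H}\le C_{\rm rel}\gamma_\bullet^{-1}\eta_\star(\mathcal R_{\star,\bullet})$, $\mathcal T_\star\setminus\mathcal T_\bullet\subseteq\mathcal R_{\star,\bullet}$ and $\#\mathcal R_{\star,\bullet}\le C_{\rm rel}\#(\mathcal T_\star\setminus\mathcal T_\bullet)$. Definiteness on $\mathcal X_\infty$: if $w\in\mathcal X_\infty$ and $b(w,v)=0$ for all $v\in\mathcal X_\infty$, then $w=0$. *)

(* Defs.v *)
From HB Require Import structures.
From mathcomp Require Import all_boot all_order all_algebra finmap.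
From mathcomp Require Import complex.
From mathcomp Require Import all_classical all_reals all_analysis.

Set Implicit Arguments.
Unset Strict Implicit.
Unset Printing Implicit Defensive.

Import Order.TTheory GRing.Theory Num.Theory.
Import numFieldNormedType.Exports.

Local Open Scope classical_set_scope.
Local Open Scope ring_scope.

Variant scalars := RealScalars | ComplexScalars.

Definition base_field (R : realType) (k : scalars) : numFieldType :=
  match k with RealScalars => R | ComplexScalars => complex R end.

Definition scalar_conj (R : realType) (k : scalars) : base_field R k -> base_field R k :=
  match k with RealScalars => id | ComplexScalars => @conjc R end.

Definition scalar_re (R : realType) (k : scalars) : base_field R k -> R :=
  match k with RealScalars => id | ComplexScalars => @complex.Re R end.

Definition of_real (R : realType) (k : scalars) : R -> base_field R k :=
  match k with RealScalars => id | ComplexScalars => fun x => Complex x 0 end.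

Arguments scalar_conj {R k}.
Arguments scalar_re {R k}.
Arguments of_real {R} k.

Section ScalarTheory.
Variables (R : realType) (k : scalars).
Local Notation K := (base_field R k).

Lemma re_of_real (x : R) : scalar_re (of_real k x) = x.
Proof. by case: k. Qed.

Lemma of_real_re_norm (x : K) : of_real k (scalar_re `|x|) = `|x|.
Proof. by case: k x => // -[]. Qed.

Lemma of_realD (x y : R) : of_real k (x + y) = of_real k x + of_real k y.
Proof. by case: k => //=; rewrite -[RHS]/(Complex _ _) /= addr0. Qed.

Lemma of_realM (x y : R) : of_real k (x * y) = of_real k x * of_real k y.
Proof.
by case: k => //=; rewrite -[RHS]/(Complex _ _) /= !(mulr0, mul0r) subr0 addr0.
Qed.

Lemma ler_of_real (x y : R) : (of_real k x <= of_real k y) = (x <= y).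
Proof. by case: k => //=; rewrite lecR. Qed.

Lemma of_real0 : of_real k (0 : R) = 0.
Proof. by case: k. Qed.

Lemma conj0 : @scalar_conj R k 0 = 0.
Proof. by case: k => //=; rewrite -[LHS]/(Complex _ _) oppr0. Qed.

Lemma conj1 : @scalar_conj R k 1 = 1.
Proof. by case: k => //=; rewrite -[LHS]/(Complex _ _) oppr0. Qed.

Lemma norm_conj (x : K) : `|scalar_conj x| = `|x|.
Proof.
case: k x => //= -[a b].
by rewrite -[LHS]/(Complex _ _) -[RHS]/(Complex _ _) /= sqrrN.
Qed.

End ScalarTheory.

Definition nrm (R : realType) (k : scalars) (V : normedModType (base_field R k))
  (v : V) : R := scalar_re `|v|.

Section NrmTheory.
Variables (R : realType) (k : scalars) (V : normedModType (base_field R k)).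
Implicit Types v w : V.

Lemma of_real_nrm v : of_real k (nrm v) = `|v|.
Proof.
by rewrite /nrm -[X in scalar_re X](@normr_id (base_field R k) V v) of_real_re_norm normr_id.
Qed.

Lemma nrm_ge0 v : 0 <= nrm v.
Proof. by rewrite -(ler_of_real k) of_real_nrm of_real0. Qed.
End NrmTheory.

Section Antidual.
Variables (R : realType) (k : scalars) (H : normedModType (base_field R k)).
Local Notation K := (base_field R k).

Definition antilinear (g : H -> K) :=
  forall (c : K) (v w : H), g (c *: v + w) = scalar_conj c * g v + g w.

Definition antidual_pred : pred (H -> K) :=
  fun g => `[< antilinear g /\ continuous (g : H -> K) >].

Lemma antidual_submod : submod_closed antidual_pred.
Proof.
split.
  apply/asboolP; split; first by move=> c v w; rewrite /= mulr0 addr0.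
  by move=> x; exact: cvg_cst.
move=> c f g /asboolP[fl fc] /asboolP[gl gc]; apply/asboolP; split.
  move=> e v w; rewrite -[LHS]/(c * f _ + g _) -[X in _ = scalar_conj _ * X + _]/(c * f v + g v).
  rewrite -[X in _ = _ + X]/(c * f w + g w) fl gl !mulrDr !addrA mulrCA.
  by rewrite -!addrA; congr (_ + _); rewrite addrCA.
move=> x; apply: cvgD; last exact: gc.
by apply: cvgM; [exact: cvg_cst|exact: fc].
Qed.

HB.instance Definition _ :=
  GRing.isSubmodClosed.Build K (H -> K) antidual_pred antidual_submod.

Record antidual := Antidual {
  pairing :> H -> K ;
  antidualP : antidual_pred pairing }.

HB.instance Definition _ := [isSub for pairing].
HB.instance Definition _ := [Choice of antidual by <:].
HB.instance Definition _ := [SubChoice_isSubLmodule of antidual by <:].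

Definition op_norm (g : antidual) : R :=
  sup [set nrm (g v : K) | v in [set v | nrm v <= 1]].

Lemma antidual_linear (g : antidual) : antilinear g.
Proof. by case: g => g /= /asboolP[]. Qed.

Lemma antidual_continuous (g : antidual) : continuous (g : H -> K).
Proof. by case: g => g /= /asboolP[]. Qed.

Lemma antidualZ (g : antidual) (c : K) (v : H) : g (c *: v) = scalar_conj c * g v.
Proof.
have g0 : g 0 = 0.
  have := antidual_linear g 1 0 0.
  by rewrite scaler0 addr0 conj1 mul1r => /eqP; rewrite -subr_eq subrr eq_sym => /eqP.
by have := antidual_linear g c v 0; rewrite !addr0 g0 addr0.
Qed.

Lemma nrm0 : nrm (0 : H) <= 1.
Proof.
by rewrite -(ler_of_real k) of_real_nrm normr0 -(of_real0 R k) ler_of_real ler01.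
Qed.

Lemma op_norm_has_sup (g : antidual) :
  has_sup [set nrm (g v : K) | v in [set v | nrm v <= 1]].
Proof.
split.
  by exists (nrm (g 0 : K)), 0; first exact: nrm0.
have g0 : g 0 = 0 by have := antidualZ g 0 0; rewrite scale0r conj0 mul0r.
have /cvgrPdist_le /(_ 1 ltr01) := @antidual_continuous g 0.
rewrite g0 => /nbhs_normP[/= e e0 He].
exists (scalar_re `|(e / 2)^-1|) => _ [v /= v1 <-].
rewrite -(ler_of_real k) of_real_nrm of_real_re_norm.
have e20 : 0 < e / 2 by rewrite divr_gt0.
rewrite normrV ?unitfE ?gt_eqF//.
rewrite -[leRHS]mul1r ler_pdivlMr ?normr_gt0 ?gt_eqF//.
rewrite mulrC -(norm_conj (e / 2)) -normrM -antidualZ.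
have := He ((e / 2) *: v); rewrite /= !sub0r !normrN; apply.
rewrite normrZ gtr0_norm//.
apply: (@le_lt_trans _ _ (e / 2)).
  rewrite ger_pMr// -of_real_nrm -[leRHS](_ : of_real k (1 : R) = 1) ?ler_of_real//.
  by case: (k).
by rewrite ltr_pdivrMr// ltr_pMr// ltr1n.
Qed.

Lemma op_norm_ge (g : antidual) (v : H) : nrm v <= 1 -> nrm (g v : K) <= op_norm g.
Proof. by move=> v1; apply: (sup_ubound (op_norm_has_sup g).2); exists v. Qed.

Lemma op_norm_le (g : antidual) (M : R) :
  (forall v, nrm v <= 1 -> nrm (g v : K) <= M) -> op_norm g <= M.
Proof.
move=> gM; apply: ge_sup; first exact: (op_norm_has_sup g).1.
by move=> _ [v /= v1 <-]; exact: gM.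
Qed.

Lemma op_norm_ge0 (g : antidual) : 0 <= op_norm g.
Proof. exact: le_trans (nrm_ge0 _) (op_norm_ge g nrm0). Qed.

Lemma ler_op_normD (f g : antidual) :
  of_real k (op_norm (f + g)) <= of_real k (op_norm f) + of_real k (op_norm g).
Proof.
rewrite -of_realD ler_of_real; apply: op_norm_le => v v1.
apply: (@le_trans _ _ (nrm (f v : K) + nrm (g v : K))); last first.
  by apply: lerD; exact: op_norm_ge.
rewrite -(ler_of_real k) of_realD !of_real_nrm.
exact: (ler_normD (f v) (g v)).
Qed.

Lemma op_normZ_le (c : K) (g : antidual) :
  of_real k (op_norm (c *: g)) <= `|c| * of_real k (op_norm g).
Proof.
rewrite -of_real_re_norm -of_realM ler_of_real; apply: op_norm_le => v v1.
rewrite -(ler_of_real k) of_real_nrm of_realM of_real_re_norm.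
rewrite [leLHS](normrM c (g v)) ler_wpM2l//.
by rewrite -of_real_nrm ler_of_real; exact: op_norm_ge.
Qed.

Lemma op_normZ (c : K) (g : antidual) :
  of_real k (op_norm (c *: g)) = `|c| * of_real k (op_norm g).
Proof.
apply/le_anti; rewrite op_normZ_le /=.
have [->|c0] := eqVneq c 0.
  by rewrite normr0 mul0r -(of_real0 R k) ler_of_real op_norm_ge0.
rewrite mulrC -ler_pdivlMr ?normr_gt0// mulrC -normfV.
have := op_normZ_le c^-1 (c *: g).
by rewrite scalerA mulVf// scale1r.
Qed.

Lemma op_norm_eq0 (g : antidual) : of_real k (op_norm g) = 0 -> g = 0.
Proof.
move=> g0; apply/val_inj/funext => v /=.
have Hw w : nrm w <= 1 -> g w = 0.
  move=> w1; apply/eqP; rewrite -normr_le0 -of_real_nrm -g0 ler_of_real.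
  exact: op_norm_ge.
have [v0|v0] := eqVneq v 0; first by rewrite v0 Hw// nrm0.
have := antidualZ g `|v|^-1 v; rewrite Hw.
  move=> /esym/eqP; rewrite mulf_eq0 => /orP[|/eqP//].
  by rewrite -normr_eq0 norm_conj normr_eq0 invr_eq0 normr_eq0 (negPf v0).
rewrite -(ler_of_real k) of_real_nrm normrZ normfV normr_id mulVf ?normr_eq0//.
by case: (k).
Qed.

HB.instance Definition _ := Lmodule_isNormed.Build K antidual
  ler_op_normD op_normZ op_norm_eq0.

Lemma antidual_normE (g : antidual) : `|g| = of_real k (op_norm g).
Proof. by []. Qed.

End Antidual.

Definition compact_operator (K : numFieldType) (V W : normedModType K)
  (g : V -> W) : Prop :=
  forall B : set V, bounded_set B -> precompact (g @` B).

Section VariationalProblem.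
Variables (R : realType) (k : scalars) (H : normedModType (base_field R k)).
Local Notation K := (base_field R k).
Variables (a : {hermitian_sym H for @scalar_conj R k}).
Variables (Kop : {linear H -> antidual H}) (f : antidual H).

Definition elliptic : Prop :=
  exists alpha : R, 0 < alpha /\
    forall v : H, alpha * nrm v ^+ 2 <= scalar_re (a v v).

Definition energy_norm (v : H) : R := Num.sqrt (scalar_re (a v v)).

Definition bform (w v : H) : K := a w v + Kop w v.

Definition well_posed : Prop :=
  forall w : H, w = 0 <-> forall v : H, bform w v = 0.

Definition finite_dim_subspace (X : set H) : Prop :=
  exists (n : nat) (e : 'I_n -> H),
    X = [set v | exists c : 'I_n -> K, v = \sum_i c i *: e i].

Definition discrete_solution (X : set H) (U : H) : Prop :=
  X U /\ forall V : H, X V -> bform U V = f V.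

Definition unique_discrete_solution (X : set H) (U : H) : Prop :=
  unique (discrete_solution X) U.

(* For X = {0} the infimum is over the empty set, where the library has
   [inf set0 = 0]. As also [0^-1 = 0], the value of [(inf_sup X)^-1] is then 0,
   as with the convention [inf set0 = +oo]. *)
Definition inf_sup (X : set H) : R :=
  inf [set sup [set nrm (bform W V : K) / (nrm W * nrm V) | V in X `\ 0]
      | W in X `\ 0].

Definition definite_on (X : set H) : Prop :=
  forall w : H, X w -> (forall v : H, X v -> bform w v = 0) -> w = 0.

End VariationalProblem.

Section Triangulations.
Variables (R : realType) (d : nat).

(* An element is a closed simplex, given by its vertices. *)
Definition element : choiceType := {fset 'rV[R]_d}.
Definition mesh : choiceType := {fset element}.

Definition hull (E : element) : set 'rV[R]_d :=
  [set x | exists w : 'rV[R]_d -> R,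
     [/\ forall p, 0 <= w p, \sum_(p <- E) w p = 1
       & x = \sum_(p <- E) w p *: p]].

Definition affinely_independent (E : element) : Prop :=
  forall w : 'rV[R]_d -> R, \sum_(p <- E) w p = 0 ->
    \sum_(p <- E) w p *: p = 0 -> forall p, p \in E -> w p = 0.

Definition simplex (E : element) : Prop :=
  #|` E | = d.+1 /\ affinely_independent E.

Definition box (l r : 'rV[R]_d) : set 'rV[R]_d :=
  [set x | forall i, l 0 i <= x 0 i <= r 0 i].

Definition lebesgue_outer (A : set 'rV[R]_d) : \bar R :=
  ereal_inf [set s | exists l r : nat -> 'rV[R]_d,
    [/\ forall j i, l j 0 i <= r j 0 i,
        A `<=` \bigcup_j box (l j) (r j)
      & s = (\sum_(0 <= j <oo) (\prod_i (r j 0 i - l j 0 i))%:E)%E]].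

Definition mesh_size (E : element) : R :=
  fine (lebesgue_outer (hull E)) `^ (d%:R^-1).

Definition scalar_product (x y : 'rV[R]_d) : R := \sum_i x 0 i * y 0 i.

Definition frontier (A : set 'rV[R]_d) : set 'rV[R]_d := closure A `\` A°.

(* Near every boundary point, Omega is the strict epigraph, in the direction of
   a unit vector e, of a Lipschitz function of the coordinates orthogonal
   to e. *)
Definition Lipschitz_boundary (Omega : set 'rV[R]_d) : Prop :=
  forall x, frontier Omega x ->
  exists (e : 'rV[R]_d) (g : 'rV[R]_d -> R) (L r : R),
    [/\ scalar_product e e = 1,
        0 < r,
        forall y z, `|g y - g z| <= L * `|y - z|,
        forall y t, g (y + t *: e) = g y
      & forall y, `|y - x| < r -> (Omega y <-> g y < scalar_product y e)].

Definition polyhedral_boundary (Omega : set 'rV[R]_d) : Prop :=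
  exists (n : nat) (nu : 'I_n -> 'rV[R]_d) (c : 'I_n -> R),
    (forall i, nu i != 0) /\
    forall x, frontier Omega x -> exists i, scalar_product x (nu i) = c i.

Definition polyhedral_Lipschitz_domain (Omega : set 'rV[R]_d) : Prop :=
  [/\ [/\ open Omega, connected Omega, Omega !=set0 & bounded_set Omega],
      polyhedral_boundary Omega & Lipschitz_boundary Omega].

Definition conforming_triangulation (Omega : set 'rV[R]_d) (T : mesh) : Prop :=
  [/\ forall E, E \in T -> simplex E,
      closure Omega = \bigcup_(E in [set E | E \in T]) hull E
    & forall E E', E \in T -> E' \in T ->
        hull E `&` hull E' = hull (E `&` E')%fset].

Definition is_refinement (T T' : mesh) : Prop :=
  forall E, E \in T ->
    hull E =
    \bigcup_(E' in [set E' | E' \in T' /\ hull E' `<=` hull E]) hull E'.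

Definition refinement_of_marked (Omega : set 'rV[R]_d)
    (adm : mesh -> mesh -> Prop) (T M T' : mesh) : Prop :=
  [/\ conforming_triangulation Omega T', adm T T', is_refinement T T'
    & (M `<=` T `\` T')%fset].

Definition coarsest_refinement (Omega : set 'rV[R]_d)
    (adm : mesh -> mesh -> Prop) (T M T' : mesh) : Prop :=
  refinement_of_marked Omega adm T M T' /\
  forall T'', refinement_of_marked Omega adm T M T'' -> (#|` T' | <= #|` T'' |)%N.

(* The strategy may restrict the triangulations among which the coarsest one is
   taken: for newest vertex bisection, [admissible T T'] says that T' arises
   from T by bisections along the prescribed refinement edges. *)
Record refinement_strategy (Omega : set 'rV[R]_d) := RefinementStrategy {
  admissible : mesh -> mesh -> Prop ;
  refine : mesh -> mesh -> mesh ;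
  refineP : forall T M : mesh,
    conforming_triangulation Omega T -> (M `<=` T)%fset ->
    coarsest_refinement Omega admissible T M (refine T M) }.

Inductive refined (Omega : set 'rV[R]_d) (S : refinement_strategy Omega)
  (T : mesh) : mesh -> Prop :=
| refined_refl : refined S T T
| refined_step T' M :
    refined S T T' -> (M `<=` T')%fset -> refined S T (refine S T' M).

Definition mesh_size_reduction (Omega : set 'rV[R]_d)
    (S : refinement_strategy Omega) (T0 : mesh) : Prop :=
  exists q : R, 0 < q < 1 /\
  forall T T', refined S T0 T -> refined S T T' ->
  forall E E', E \in (T `\` T')%fset -> E' \in T' -> hull E' `<=` hull E ->
    mesh_size E' <= q * mesh_size E.

End Triangulations.

Section AdaptiveFEM.
Variables (R : realType) (k : scalars) (H : normedModType (base_field R k)).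
Local Notation K := (base_field R k).
Variables (a : {hermitian_sym H for @scalar_conj R k}).
Variables (Kop : {linear H -> antidual H}) (f : antidual H).
Variables (d : nat) (Omega : set 'rV[R]_d) (S : refinement_strategy Omega).
Variables (T0 : mesh R d) (X : mesh R d -> set H).
Variables (eta : mesh R d -> element R d -> R).

Definition nested_spaces : Prop :=
  (forall T, refined S T0 T -> finite_dim_subspace (X T)) /\
  (forall T T', refined S T0 T -> refined S T T' -> X T `<=` X T').

Definition uniform_density : Prop :=
  forall (T M : nat -> mesh R d),
    T 0%N = T0 ->
    (forall l, (M l `<=` T l)%fset /\ T l.+1 = refine S (T l) (M l)) ->
    (forall n, exists l, (n <= l)%N /\ M l = T l) ->
    dense (\bigcup_l X (T l)).

Local Notation solution T U := (unique_discrete_solution a Kop f (X T) U).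

Definition estimator_on (T P : mesh R d) : R :=
  Num.sqrt (\sum_(E <- P) eta T E ^+ 2).

Definition estimator (T : mesh R d) : R := estimator_on T T.

Definition nonneg_indicators : Prop :=
  forall T U E, refined S T0 T -> solution T U -> E \in T -> 0 <= eta T E.

Definition stability : Prop :=
  exists C : R, 0 < C /\
  forall T T' U U', refined S T0 T -> refined S T T' ->
    solution T U -> solution T' U' ->
    `|estimator_on T' (T' `&` T)%fset - estimator_on T (T' `&` T)%fset|
      <= C * nrm (U' - U).

Definition reduction : Prop :=
  exists C q : R, 0 < C /\ 0 < q < 1 /\
  forall T T' U U', refined S T0 T -> refined S T T' ->
    solution T U -> solution T' U' ->
    estimator_on T' (T' `\` T)%fset ^+ 2
      <= q * estimator_on T (T `\` T')%fset ^+ 2 + C ^+ 2 * nrm (U' - U) ^+ 2.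

Definition reliability (u : H) : Prop :=
  exists C : R, 0 < C /\
  forall T U, refined S T0 T -> solution T U -> nrm (u - U) <= C * estimator T.

Definition discrete_reliability : Prop :=
  exists C : R, 0 < C /\
  forall T T', refined S T0 T -> refined S T T' ->
  exists P : mesh R d, (P `<=` T)%fset /\
  forall U U', solution T U -> solution T' U' ->
    [/\ nrm (U' - U) <= C * (inf_sup a Kop (X T'))^-1 * estimator_on T P,
        (T `\` T' `<=` P)%fset
      & #|` P |%:R <= C * #|` (T `\` T')%fset |%:R].

Definition Doerfler (theta : R) (T M : mesh R d) : Prop :=
  (M `<=` T)%fset /\ theta * estimator T ^+ 2 <= estimator_on T M ^+ 2.

Definition quasi_minimal_Doerfler (theta Cmark : R) (T M : mesh R d) : Prop :=
  Doerfler theta T M /\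
  forall M', Doerfler theta T M' -> #|` M |%:R <= Cmark * #|` M' |%:R.

(* [previous x0 s l] is s_(l-1), with s_(-1) = x0. *)
Definition previous (A : Type) (x0 : A) (s : nat -> A) (l : nat) : A :=
  if l is l'.+1 then s l' else x0.

Definition adaptive_output (theta Cmark : R)
    (T : nat -> mesh R d) (U : nat -> H) (est : nat -> R) : Prop :=
  T 0%N = T0 /\
  forall l : nat,
    [/\ ~ (exists W, solution (T l) W),
        U l = previous 0 U l,
        est l = previous 1 est l
      & T l.+1 = refine S (T l) (T l)]
    \/
    [/\ solution (T l) (U l),
        est l = estimator (T l)
      & exists M, quasi_minimal_Doerfler theta Cmark (T l) M /\
          T l.+1 = refine S (T l) M].

Definition limit_space (T : nat -> mesh R d) : set H :=
  closure (\bigcup_l X (T l)).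

End AdaptiveFEM.

(* Main.v *)
Require Import Defs.
From HB Require Import structures.
From mathcomp Require Import all_boot all_order all_algebra finmap.
From mathcomp Require Import complex.
From mathcomp Require Import all_classical all_reals all_analysis.
From mathcomp Require Import lra ring.

Set Implicit Arguments.
Unset Strict Implicit.
Unset Printing Implicit Defensive.

Import Order.TTheory GRing.Theory Num.Theory.
Import numFieldNormedType.Exports.

Local Open Scope classical_set_scope.
Local Open Scope ring_scope.

(** The error e = u - U_l satisfies b(e, V) = 0 for all V in X_l, so

      a(e, e) = a(e, u - V) - <K e, V - U_l>.

    The first term alone would make U_l the a-best approximation
    (Cauchy-Schwarz for a); the second one is at most
    |K e| (|e| + |u - V|). Hence the constant is (1 + s) / (1 - s), where s is
    |K e| / (alpha |e|), and everything rests on |K e_l| = o(|e_l|)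
    ([compact_part_small], [galerkin_quasi_optimal]).

    That smallness is a weak-convergence phenomenon: normalised errors that
    lie in the limit space and are b-orthogonal to larger and larger X_l can
    only converge weakly to a solution of the homogeneous problem there, which
    is 0 by definiteness, and a compact K turns weak convergence into strong
    convergence. The proof replaces weak limits by a cluster point g of the
    functionals K e_n: the Riesz representative z of -g with respect to a plays
    the role of the weak limit, K z = g follows by representing the functionals
    v |-> <K v, x>, and so b(z, .) = 0 ([compact_part_small]). Riesz
    representatives in the limit space are limits of Galerkin solutions
    ([riesz_closure]).

    The same smallness shows that b is definite on X_l for large l, so that the
    discrete problems become uniquely solvable, that the U_l stay bounded, and
    that they form a Cauchy sequence ([discrete_well_posed],
    [discrete_bounded], [discrete_cauchy]). The latter uses that
    a(U_m - U_l, U_m - U_l) differs from a(U_m, U_m) - a(U_l, U_l) by a term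
    that K controls, and that a bounded, almost monotone real sequence is
    Cauchy; it does not involve the exact solution.

    The errors lie in the limit space only if u does, and this is where
    adaptivity enters. By stability, reduction and the marking criterion the
    squared estimator is contracted up to a multiple of |U_{l+1} - U_l|^2,
    which tends to 0 ([doerfler_contraction], [adaptive_estimator_cvg0]);
    reliability then gives U_l -> u.

    As the norms of the spaces take values in the scalar field, limits are
    expressed through the real-valued [nrm] with real tolerances; this treats
    real and complex scalars alike. *)

(** * Scalars and real-valued norms *)

Section Scalars.
Variables (R : realType) (k : scalars).
Local Notation K := (base_field R k).
Implicit Types (x y : K) (r s : R).

Lemma scalar_reD x y : scalar_re (x + y) = scalar_re x + scalar_re y.
Proof. by case: k x y => //= -[? ?] [? ?]. Qed.

Lemma scalar_reN x : scalar_re (- x) = - scalar_re x.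
Proof. by case: k x => //= -[? ?]. Qed.

Lemma scalar_reB x y : scalar_re (x - y) = scalar_re x - scalar_re y.
Proof. by rewrite scalar_reD scalar_reN. Qed.

Lemma scalar_re_conj x : scalar_re (scalar_conj x) = scalar_re x.
Proof. by case: k x => //= -[? ?]. Qed.

Lemma scalar_reZ r x : scalar_re (of_real k r * x) = r * scalar_re x.
Proof.
by case: k x => //= -[p q]; rewrite -[LHS]/(r * p - 0 * q) mul0r subr0.
Qed.

Lemma scalar_re_le_nrm x : scalar_re x <= nrm (x : K).
Proof.
case: k x => [x|]; first exact: ler_norm.
move=> [p q]; rewrite -[leRHS]/(Num.sqrt (p ^+ 2 + q ^+ 2)).
apply: le_trans (ler_norm _) _; rewrite -sqrtr_sqr.
by rewrite ler_wsqrtr// lerDl sqr_ge0.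
Qed.

Lemma conj_of_real r : scalar_conj (of_real k r) = of_real k r.
Proof. by case: k => //=; rewrite -[LHS]/(Complex _ _) oppr0. Qed.

Lemma scalar_conjD x y : scalar_conj (x + y) = scalar_conj x + scalar_conj y.
Proof.
case: k x y => //= -[? ?] [? ?].
by rewrite -[LHS]/(Complex _ _) -[RHS]/(Complex _ _) opprD.
Qed.

Lemma scalar_conjM x y : scalar_conj (x * y) = scalar_conj x * scalar_conj y.
Proof.
case: k x y => //= -[p q] [p' q'].
rewrite -[LHS]/(Complex (p * p' - q * q') (- (p * q' + q * p'))).
rewrite -[RHS]/(Complex (p * p' - (- q) * (- q')) (p * (- q') + (- q) * p')).
by rewrite mulrNN mulrN mulNr opprD.
Qed.

Lemma scalar_conjK : involutive (@scalar_conj R k).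
Proof. by case: k => //= -[p q]; rewrite -[LHS]/(Complex _ _) opprK. Qed.

Lemma of_realN r : of_real k (- r) = - of_real k r.
Proof. by apply/eqP; rewrite -addr_eq0 -of_realD addNr of_real0. Qed.

Lemma of_real1 : of_real k (1 : R) = 1.
Proof. by case: k. Qed.

Lemma of_real_inj : injective (@of_real R k).
Proof. by move=> r s rs; apply/le_anti; rewrite -!(ler_of_real k) rs lexx. Qed.

Lemma ltr_of_real r s : (of_real k r < of_real k s) = (r < s).
Proof. by rewrite !lt_def ler_of_real (inj_eq of_real_inj). Qed.

Lemma of_real_gt0 r : (0 < of_real k r) = (0 < r).
Proof. by rewrite -ltr_of_real of_real0. Qed.
End Scalars.

Section Norms.
Variables (R : realType) (k : scalars) (V : normedModType (base_field R k)).
Local Notation K := (base_field R k).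
Implicit Types (v w : V).

Lemma nrm_lt v (r : R) : (nrm v < r) = (`|v| < of_real k r).
Proof. by rewrite -of_real_nrm ltr_of_real. Qed.

Lemma nrmD v w : nrm (v + w) <= nrm v + nrm w.
Proof. by rewrite -(ler_of_real k) of_realD !of_real_nrm ler_normD. Qed.

Lemma nrmZ (c : K) v : nrm (c *: v) = nrm (c : K) * nrm v.
Proof. by apply: (@of_real_inj R k); rewrite of_realM !of_real_nrm normrZ. Qed.

Lemma nrmN v : nrm (- v) = nrm v.
Proof. by rewrite /nrm normrN. Qed.

Lemma nrmBC v w : nrm (v - w) = nrm (w - v).
Proof. by rewrite /nrm distrC. Qed.

Lemma nrm_zero : nrm (0 : V) = 0.
Proof. by apply: (@of_real_inj R k); rewrite of_real_nrm normr0 of_real0. Qed.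

Lemma nrm_eq0 v : nrm v = 0 -> v = 0.
Proof.
by move=> v0; apply/normr0_eq0; rewrite -of_real_nrm v0 of_real0.
Qed.

Lemma nrm_gt0 v : v != 0 -> 0 < nrm v.
Proof.
by move=> v0; rewrite lt_def nrm_ge0 andbT; apply: contra_neq v0 => /nrm_eq0.
Qed.

Lemma nrm_closure (A : set V) v :
  closure A v <-> forall e : R, 0 < e -> exists2 w, A w & nrm (v - w) < e.
Proof.
split=> [Av e e0|Av B].
  have /Av[w [Aw /= vw]] : nbhs v (ball v (of_real k e)).
    by apply: nbhsx_ballx; rewrite of_real_gt0.
  by exists w => //; rewrite nrm_lt; move: vw; rewrite -ball_normE.
move=> /nbhs_ballP[/= e e0 vB].
have /Av[w Aw vw] : 0 < scalar_re `|e|.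
  by rewrite -(of_real_gt0 k) of_real_re_norm normr_gt0 gt_eqF.
exists w; split=> //; apply: vB; rewrite -ball_normE /=.
by move: vw; rewrite nrm_lt of_real_re_norm gtr0_norm.
Qed.
End Norms.

Lemma nrmM (R : realType) (k : scalars) (x y : base_field R k) :
  nrm (x * y : base_field R k) = nrm (x : base_field R k) * nrm (y : base_field R k).
Proof. by rewrite -nrmZ. Qed.

Lemma nrm_of_real (R : realType) (k : scalars) (r : R) :
  nrm (of_real k r : base_field R k) = `|r|.
Proof.
case: k => //=; rewrite -[LHS]/(Num.sqrt (r ^+ 2 + 0 ^+ 2)).
by rewrite expr0n addr0 sqrtr_sqr.
Qed.

Lemma nrm_of_real_inv (R : realType) (k : scalars)
    (V : normedModType (base_field R k)) (v : V) :
  nrm (of_real k (nrm v)^-1 : base_field R k) = (nrm v)^-1.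
Proof. by rewrite nrm_of_real ger0_norm// invr_ge0 nrm_ge0. Qed.

Lemma nrm_conj (R : realType) (k : scalars) (x : base_field R k) :
  nrm (scalar_conj x : base_field R k) = nrm (x : base_field R k).
Proof. by rewrite /nrm norm_conj. Qed.

Lemma nrm_cauchy_cvg (R : realType) (k : scalars)
    (V : completeNormedModType (base_field R k)) (w : nat -> V) :
  (forall e : R, 0 < e -> exists N, forall l m, (N <= l <= m)%N ->
     nrm (w m - w l) < e) ->
  exists z, forall e : R, 0 < e -> exists N, forall l, (N <= l)%N ->
     nrm (z - w l) < e.
Proof.
move=> wC.
have : cauchy (w @ \oo).
  apply/cauchyP => /= e e0.
  have [N wN] : exists N, forall l m, (N <= l <= m)%N ->
      nrm (w m - w l) < scalar_re `|e|.
    by apply: wC; rewrite -(of_real_gt0 k) of_real_re_norm normr_gt0 gt_eqF.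
  exists (w N); exists N => // m /= Nm; rewrite -ball_normE /=.
  by have := wN N m; rewrite leqnn Nm nrm_lt of_real_re_norm gtr0_norm// distrC; apply.
move=> /cauchy_cvg/cvg_ex[z wz]; exists z => e e0.
have e0' : 0 < of_real k e by rewrite of_real_gt0.
have /cvgrPdist_lt/(_ _ e0')[N _ zN] := wz.
by exists N => l Nl; rewrite nrm_lt; exact: zN.
Qed.

(** * Sesquilinear forms and finite-dimensional Galerkin problems *)

Section Sesquilinear.
Variables (R : realType) (k : scalars) (H : normedModType (base_field R k)).
Local Notation K := (base_field R k).

Section Antilinear.
Variables (g : H -> K) (gL : antilinear g).

Lemma antilinear0 : g 0 = 0.
Proof.
have := gL 1 0 0; rewrite scaler0 addr0 conj1 mul1r => /eqP.
by rewrite -subr_eq subrr eq_sym => /eqP.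
Qed.

Lemma antilinearD v w : g (v + w) = g v + g w.
Proof. by have := gL 1 v w; rewrite scale1r conj1 mul1r. Qed.

Lemma antilinearZ c v : g (c *: v) = scalar_conj c * g v.
Proof. by have := gL c v 0; rewrite !addr0 antilinear0 addr0. Qed.

Lemma antilinearB v w : g (v - w) = g v - g w.
Proof.
by have := gL (- 1) w v; rewrite scaleN1r addrC => ->;
   rewrite -(of_real1 R k) -of_realN conj_of_real of_realN of_real1 mulN1r addrC.
Qed.

Lemma antilinear_sum n (c : 'I_n -> K) (e : 'I_n -> H) :
  g (\sum_i c i *: e i) = \sum_i scalar_conj (c i) * g (e i).
Proof.
rewrite (big_morph g antilinearD antilinear0).
by apply: eq_bigr => i _; rewrite antilinearZ.
Qed.
End Antilinear.

Lemma antilinear_diff (g h : H -> K) :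
  antilinear g -> antilinear h -> antilinear (fun v => g v - h v).
Proof.
move=> gL hL c v w; rewrite gL hL mulrBr opprD !addrA; congr (_ - _).
by rewrite -!addrA; congr (_ + _); rewrite addrC.
Qed.

Definition sesquilinear (b : H -> H -> K) : Prop :=
  (forall x, scalar (b^~ x)) /\ (forall v, antilinear (b v)).

Section Form.
Variables (b : H -> H -> K) (bS : sesquilinear b).

Lemma sesquiDl v w x : b (v + w) x = b v x + b w x.
Proof. by have := bS.1 x 1 v w; rewrite scale1r mul1r. Qed.

Lemma sesqui0l x : b 0 x = 0.
Proof.
have := sesquiDl 0 0 x; rewrite addr0 => /eqP.
by rewrite -subr_eq subrr eq_sym => /eqP.
Qed.

Lemma sesquiZl c v x : b (c *: v) x = c * b v x.
Proof. by have := bS.1 x c v 0; rewrite !addr0 sesqui0l addr0. Qed.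

Lemma sesquiBl v w x : b (v - w) x = b v x - b w x.
Proof. by rewrite -scaleN1r sesquiDl sesquiZl mulN1r. Qed.

Lemma sesqui_suml n (c : 'I_n -> K) (e : 'I_n -> H) x :
  b (\sum_i c i *: e i) x = \sum_i c i * b (e i) x.
Proof.
rewrite (big_morph (b^~ x) (fun v w => sesquiDl v w x) (sesqui0l x)).
by apply: eq_bigr => i _; rewrite sesquiZl.
Qed.

Lemma sesqui0r v : b v 0 = 0. Proof. exact: antilinear0 (bS.2 v). Qed.

Lemma sesquiDr v w x : b v (w + x) = b v w + b v x.
Proof. exact: antilinearD (bS.2 v) w x. Qed.

Lemma sesquiBr v w x : b v (w - x) = b v w - b v x.
Proof. exact: antilinearB (bS.2 v) w x. Qed.

Lemma sesquiZr v c x : b v (c *: x) = scalar_conj c * b v x.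
Proof. exact: antilinearZ (bS.2 v) c x. Qed.
End Form.

(** The generating family of X need not be free, so the Galerkin matrix of b may
    be singular. The Gram matrix of the definite form G has the same left
    kernel, because both kernels describe the linear relations of the family.
    Hence the two ranks agree; the row space of the Gram matrix contains every
    row that vanishes on those relations, in particular the right-hand side,
    and it contains, hence equals, the row space of the Galerkin matrix. *)
Lemma galerkin_exists (G b : H -> H -> K) (X : set H) (g : H -> K) :
  sesquilinear G -> (forall v, G v v = 0 -> v = 0) ->
  sesquilinear b -> finite_dim_subspace X ->
  (forall w, X w -> (forall v, X v -> b w v = 0) -> w = 0) ->
  antilinear g -> exists2 w, X w & forall v, X v -> b w v = g v.
Proof.
move=> GS G0 bS [n [e Xe]] bdef gL.
pose comb (c : 'rV[K]_n) := \sum_i c 0 i *: e i.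
have Xcomb c : X (comb c) by rewrite Xe; exists (c 0).
have formE (h : H -> H -> K) (hS : sesquilinear h) (c : 'rV[K]_n) j :
    (c *m \matrix_(i, j) h (e i) (e j)) 0 j = h (comb c) (e j).
  rewrite mxE (sesqui_suml hS); apply: eq_bigr => i _; by rewrite mxE.
have vanish (h : H -> K) (hL : antilinear h) :
    (forall j, h (e j) = 0) -> forall v, X v -> h v = 0.
  move=> h0 v; rewrite Xe => -[c ->]; rewrite (antilinear_sum hL).
  by rewrite big1// => i _; rewrite h0 mulr0.
pose GM : 'M[K]_n := \matrix_(i, j) G (e i) (e j).
pose BM : 'M[K]_n := \matrix_(i, j) b (e i) (e j).
pose gM : 'rV[K]_n := \row_j g (e j).
have ker0 (c : 'rV[K]_n) : (c *m BM == 0) = (c *m GM == 0).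
  suff E : (comb c = 0 -> c *m BM = 0 /\ c *m GM = 0) /\
           (c *m BM = 0 -> comb c = 0) /\ (c *m GM = 0 -> comb c = 0).
    by apply/eqP/eqP => [/E.2.1/E.1[]//|/E.2.2/E.1[]].
  split=> [c0|].
    split; apply/rowP => j; rewrite formE// c0 mxE; exact: sesqui0l.
  split=> [cB|cG].
    apply: bdef => //; apply: vanish; first exact: bS.2.
    by move=> j; rewrite -formE// cB mxE.
  apply: G0; apply: (vanish (G (comb c))); [exact: GS.2| |exact: Xcomb].
  by move=> j; rewrite -formE// cG mxE.
have rankBG : \rank BM = \rank GM.
  have kerS (A B : 'M[K]_n) : (forall c : 'rV_n, (c *m A == 0) = (c *m B == 0)) ->
      (kermx A <= kermx B)%MS.
    move=> AB; apply/row_subP => i; apply/sub_kermxP/eqP; rewrite -AB.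
    by apply/eqP/sub_kermxP; exact: row_sub.
  have : \rank (kermx BM) = \rank (kermx GM).
    apply/eqP; rewrite eqn_leq !mxrankS// kerS//.
  rewrite !mxrank_ker => /(congr1 (subn n)).
  by rewrite !subKn// rank_leq_row.
(* Since G is conjugate-linear on the right, a right kernel vector of the Gram
   matrix is the conjugate of a relation of the family. *)
have cok (v : 'I_n -> K) : (forall i, \sum_j v j * G (e i) (e j) = 0) ->
    \sum_j scalar_conj (v j) *: e j = 0.
  move=> v0; apply: G0; set w := \sum_j _.
  have Gw i : G (e i) w = 0.
    rewrite (antilinear_sum (GS.2 _)) -[RHS](v0 i).
    by apply: eq_bigr => j _; rewrite scalar_conjK.
  rewrite {1}/w (sesqui_suml GS) big1// => i _.
  by rewrite Gw mulr0.
have subG m (h : 'I_m -> H -> K) (hL : forall i, antilinear (h i)) :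
    (\matrix_(i < m, j < n) h i (e j) <= GM)%MS.
  rewrite submxE; apply/eqP/matrixP => i l; rewrite !mxE.
  pose v j := cokermx GM j l.
  have /cok v0 : forall i, \sum_j v j * G (e i) (e j) = 0.
    move=> i'; have /matrixP/(_ i' l) := mulmx_coker GM.
    rewrite !mxE => GM0; rewrite -[RHS]GM0; apply: eq_bigr => j _.
    by rewrite /v !mxE mulrC.
  have := antilinear0 (hL i); rewrite -[X in h i X]v0 (antilinear_sum (hL i)).
  move=> h0; rewrite -[RHS]h0; apply: eq_bigr => j _.
  by rewrite scalar_conjK mulrC; congr (_ * _); rewrite mxE.
have BG : (BM <= GM)%MS by apply: (subG n (fun i => b (e i))) => i; exact: bS.2.
have GB : (GM <= BM)%MS by rewrite -(mxrank_leqif_sup BG).2 rankBG.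
have gB : (gM <= BM)%MS by apply: submx_trans GB; exact: (subG 1%N (fun=> g) (fun=> gL)).
have /submxP[c gc] := gB.
exists (comb c); first exact: Xcomb.
move=> v Xv; apply/eqP; rewrite -subr_eq0; apply/eqP.
apply: (vanish _ (antilinear_diff (bS.2 (comb c)) gL)) Xv.
by move=> j; rewrite -formE// -/BM -gc mxE subrr.
Qed.
End Sesquilinear.

(** * The energy norm *)

(** The supremum of a late tail is nearly attained at one index; from there on
    no term falls much below that value and none exceeds the supremum. *)
Lemma almost_nondecreasing_cauchy (R : realType) (x : nat -> R) (B : R) :
  (forall n, x n <= B) ->
  (forall e : R, 0 < e -> exists N, forall l m, (N <= l <= m)%N ->
     x l <= x m + e) ->
  forall e : R, 0 < e -> exists N, forall l m, (N <= l <= m)%N ->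
     x m - x l <= e.
Proof.
move=> xB xI e e0; have e20 : 0 < e / 2 by rewrite divr_gt0.
have [N xN] := xI _ e20.
pose A := [set x n | n in [set n | (N <= n)%N]].
have Asup : has_sup A.
  by split; [exists (x N), N => //=|exists B => _ [n _ <-]].
have [_ [n0 /= Nn0 <-] n0s] := sup_adherent e20 Asup.
exists n0 => l m /andP[n0l lm].
have : x m <= sup A.
  apply: (sup_ubound Asup.2); exists m => //=.
  exact: leq_trans (leq_trans Nn0 n0l) lm.
have : x n0 <= x l + e / 2 by apply: xN; rewrite Nn0.
by lra.
Qed.

Section Energy.
Variables (R : realType) (k : scalars) (H : normedModType (base_field R k)).
Local Notation K := (base_field R k).
Variables (a : {hermitian_sym H for @scalar_conj R k}).

Lemma hermitian_sesquilinear : sesquilinear a.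
Proof.
split=> [x c v w|v c w x]; first by rewrite linearPl.
by rewrite linearPr.
Qed.
Let aS := hermitian_sesquilinear.

Lemma hermitian_conj v w : a v w = scalar_conj (a w v).
Proof. by have := @hermitian_subproof _ _ _ _ a v w; rewrite expr0 mul1r. Qed.

Lemma hermitian_reC v w : scalar_re (a v w) = scalar_re (a w v).
Proof. by rewrite hermitian_conj scalar_re_conj. Qed.

(** When v - w is a-orthogonal to w, this is Pythagoras: the squared distance is
    a gap of squared energies. *)
Lemma hermitian_reB v w :
  scalar_re (a (v - w) (v - w)) =
  scalar_re (a v v) - scalar_re (a w w) - 2 * scalar_re (a (v - w) w).
Proof.
rewrite !(sesquiBl aS) !(sesquiBr aS) !scalar_reB (hermitian_reC w v).
by ring.
Qed.

Variables (alpha : R) (alpha_gt0 : 0 < alpha).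
Hypothesis a_ell : forall v : H, alpha * nrm v ^+ 2 <= scalar_re (a v v).

Lemma energy_ge0 v : 0 <= scalar_re (a v v).
Proof. by apply: le_trans (a_ell v); rewrite mulr_ge0 ?sqr_ge0// ltW. Qed.

Lemma energy_norm_sqr v : energy_norm a v ^+ 2 = scalar_re (a v v).
Proof. by rewrite sqr_sqrtr// energy_ge0. Qed.

Lemma energy_definite v : a v v = 0 -> v = 0.
Proof.
move=> av0; apply: nrm_eq0; apply/eqP; rewrite -sqrf_eq0.
have := a_ell v; rewrite av0 -(of_real0 R k) re_of_real.
by rewrite pmulr_rle0// => nv0; rewrite eq_le nv0 sqr_ge0.
Qed.

Lemma energy_cauchy_schwarz v w :
  scalar_re (a v w) <= energy_norm a v * energy_norm a w.
Proof.
set p := scalar_re (a v w); set s := energy_norm a v; set t := energy_norm a w.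
have t0 : 0 <= t by exact: sqrtr_ge0.
have s0 : 0 <= s by exact: sqrtr_ge0.
have E r : 0 <= s ^+ 2 - 2 * r * p + r ^+ 2 * t ^+ 2.
  have := energy_ge0 (v - of_real k r *: w).
  rewrite hermitian_reB !(sesquiBl aS) !(sesquiZl aS) !(sesquiZr aS).
  rewrite !conj_of_real !scalar_reB !scalar_reZ -!energy_norm_sqr -/s -/t -/p.
  by congr (_ <= _); ring.
have [t00|t00] := eqVneq t 0.
  have [p0|p0] := leP p 0; first by rewrite t00 mulr0.
  (* For t = 0 the polynomial is affine in r; this value makes it negative. *)
  have := E ((s ^+ 2 + 1) / (2 * p)).
  rewrite t00 expr0n mulr0 addr0.
  have -> : 2 * ((s ^+ 2 + 1) / (2 * p)) * p = s ^+ 2 + 1.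
    by field; rewrite gt_eqF.
  by lra.
have tp : 0 < t by rewrite lt_def t00.
(* The minimiser of the quadratic polynomial in E. *)
have := E (p / t ^+ 2).
have -> : s ^+ 2 - 2 * (p / t ^+ 2) * p + (p / t ^+ 2) ^+ 2 * t ^+ 2 =
          s ^+ 2 - p ^+ 2 / t ^+ 2 by field.
rewrite subr_ge0 ler_pdivrMr ?exprn_gt0// -exprMn => pst.
apply: le_trans (ler_norm _) _; rewrite -sqrtr_sqr.
by rewrite -[leRHS]ger0_norm ?mulr_ge0// -(sqrtr_sqr (s * t)) ler_wsqrtr.
Qed.

End Energy.

(** * Subspaces, functionals and closures *)

Section Chain.
Variables (R : realType) (k : scalars) (H : normedModType (base_field R k)).
Local Notation K := (base_field R k).

Lemma finite_dim_subspace_lin (A : set H) (c : K) (v w : H) :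
  finite_dim_subspace A -> A v -> A w -> A (c *: v + w).
Proof.
move=> [n [e ->]] [s ->] [t ->]; exists (fun i => c * s i + t i).
rewrite scaler_sumr -big_split /=; apply: eq_bigr => i _.
by rewrite scalerDl scalerA.
Qed.

Lemma finite_dim_subspace0 (A : set H) : finite_dim_subspace A -> A 0.
Proof.
move=> [n [e ->]]; exists (fun=> 0); rewrite big1// => i _.
by rewrite scale0r.
Qed.

Lemma finite_dim_subspaceB (A : set H) (v w : H) :
  finite_dim_subspace A -> A v -> A w -> A (v - w).
Proof.
move=> Af Av Aw; rewrite addrC -scaleN1r; exact: finite_dim_subspace_lin.
Qed.

Lemma antilinear_vanish_closure (g : H -> K) (C : R) (A : set H) :
  antilinear g -> (forall v, nrm (g v : K) <= C * nrm v) ->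
  (forall v, A v -> g v = 0) -> forall v, closure A v -> g v = 0.
Proof.
move=> gL gC gA v /nrm_closure Av; apply: (@nrm_eq0 R k K).
have C1 : 0 < `|C| + 1 by rewrite ltr_wpDl.
apply/eqP; apply: contraT => gv0.
have gv : 0 < nrm (g v : K) by rewrite lt_def gv0 nrm_ge0.
have [w Aw vw] := Av _ (divr_gt0 gv C1).
have : nrm (g v : K) <= C * nrm (v - w).
  by rewrite -[X in nrm (X : K)]subr0 -(gA w Aw) -(antilinearB gL).
have : C * nrm (v - w) <= (`|C| + 1) * nrm (v - w).
  by rewrite ler_wpM2r ?nrm_ge0//; have := ler_norm C; lra.
move: vw; rewrite ltr_pdivlMr// mulrC => h1 h2 h3.
by have := lt_le_trans h1 (le_trans h3 h2); rewrite ltxx.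
Qed.

(** Continuity at the origin bounds the form on a small bidisc; homogeneity
    scales this bound to all arguments. *)
Lemma sesquilinear_bounded (b : H -> H -> K) :
  sesquilinear b -> continuous (fun p : H * H => b p.1 p.2) ->
  exists2 M, 0 < M & forall v w, nrm (b v w : K) <= M * nrm v * nrm w.
Proof.
move=> bS bc; have /cvgrPdist_lt/(_ 1 ltr01) := bc (0, 0).
move=> [[A B] /= [/nbhs_ballP[/= e e0 eA] /nbhs_ballP[/= r r0 rB]] AB].
pose t := Num.min (scalar_re `|e|) (scalar_re `|r|) / 2.
have re_gt0 (x : K) : 0 < x -> 0 < scalar_re `|x|.
  by move=> x0; rewrite -(of_real_gt0 k) of_real_re_norm normr_gt0 gt_eqF.
have t0 : 0 < t by rewrite divr_gt0// lt_min !re_gt0.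
have t_ball (s : K) : 0 < s -> t < scalar_re `|s| ->
    forall v : H, nrm v <= t -> ball 0 s v.
  move=> s0 ts v vt; rewrite -ball_normE /= sub0r normrN -(gtr0_norm s0).
  by rewrite -of_real_re_norm -nrm_lt (le_lt_trans vt).
have half (x : R) : 0 < x -> Num.min (scalar_re `|e|) (scalar_re `|r|) <= x -> t < x.
  by move=> x0 mx; rewrite ltr_pdivrMr// (le_lt_trans mx)// ltr_pMr// ltr1n.
have tA v : nrm v <= t -> A v.
  by move=> vt; apply/eA/t_ball => //; apply: half; rewrite ?re_gt0// ge_min lexx.
have tB v : nrm v <= t -> B v.
  move=> vt; apply/rB/t_ball => //; apply: half; rewrite ?re_gt0//.
  by rewrite ge_min lexx orbT.
have small v w : nrm v <= t -> nrm w <= t -> nrm (b v w : K) <= 1.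
  move=> vt wt; have := AB (v, w) (conj (tA _ vt) (tB _ wt)).
  rewrite /= (sesqui0l bS) sub0r normrN -(of_real1 R k) -nrm_lt.
  exact: ltW.
exists (t ^- 2) => [|v w]; first by rewrite invr_gt0 exprn_gt0.
have [->|v0] := eqVneq v 0; first by rewrite (sesqui0l bS) !nrm_zero mulr0 mul0r.
have [->|w0] := eqVneq w 0; first by rewrite (sesqui0r bS) !nrm_zero mulr0.
have nv := nrm_gt0 v0; have nw := nrm_gt0 w0.
have scaled (x : H) : x != 0 -> nrm (of_real k (t / nrm x) *: x) <= t.
  move=> x0; have nx := nrm_gt0 x0.
  by rewrite nrmZ nrm_of_real (ger0_norm (divr_ge0 (ltW t0) (ltW nx))) divfK// gt_eqF.
have := small _ _ (scaled v v0) (scaled w w0).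
rewrite (sesquiZl bS) (sesquiZr bS) conj_of_real !nrmM !nrm_of_real.
rewrite (ger0_norm (divr_ge0 (ltW t0) (ltW nv))).
rewrite (ger0_norm (divr_ge0 (ltW t0) (ltW nw))) mulrA.
have -> : t / nrm v * (t / nrm w) = t ^+ 2 / (nrm v * nrm w).
  by field; rewrite !gt_eqF.
rewrite mulrAC ler_pdivrMr ?mulr_gt0// mul1r => h.
by rewrite -mulrA mulrC ler_pdivlMr ?exprn_gt0// mulrC.
Qed.

Lemma closure_lin (X : nat -> set H) (c : K) (v w : H) :
  (forall l, finite_dim_subspace (X l)) ->
  (forall l m, (l <= m)%N -> X l `<=` X m) ->
  closure (\bigcup_l X l) v -> closure (\bigcup_l X l) w ->
  closure (\bigcup_l X l) (c *: v + w).
Proof.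
move=> Xfin Xmono /nrm_closure Yv /nrm_closure Yw; apply/nrm_closure => e e0.
have nc : 0 < nrm (c : K) + 1 by rewrite ltr_wpDl ?nrm_ge0.
have [v' [l _ v'l] vv'] : exists2 v', (\bigcup_l X l) v' &
    nrm (v - v') < e / 2 / (nrm (c : K) + 1).
  by apply: Yv; rewrite !divr_gt0.
have [w' [m _ w'm] ww'] : exists2 w', (\bigcup_l X l) w' & nrm (w - w') < e / 2.
  by apply: Yw; rewrite !divr_gt0.
exists (c *: v' + w').
  exists (maxn l m) => //; apply: finite_dim_subspace_lin => //.
    by apply: Xmono v'l; exact: leq_maxl.
  by apply: Xmono w'm; exact: leq_maxr.
have -> : c *: v + w - (c *: v' + w') = c *: (v - v') + (w - w').
  by rewrite scalerBr opprD addrACA.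
apply: le_lt_trans (nrmD _ _) _; rewrite nrmZ.
move: vv'; rewrite ltr_pdivlMr// => vv'.
have := nrm_ge0 (v - v'); lra.
Qed.

End Chain.

(** * Riesz representation in the closure of a chain of subspaces *)

Section Riesz.
Variables (R : realType) (k : scalars) (H : completeNormedModType (base_field R k)).
Local Notation K := (base_field R k).
Variables (a : {hermitian_sym H for @scalar_conj R k}).
Variables (alpha : R) (alpha_gt0 : 0 < alpha).
Hypothesis a_ell : forall v : H, alpha * nrm v ^+ 2 <= scalar_re (a v v).
Let aS := hermitian_sesquilinear a.

(** Positivity of a makes the energies a(w_n, w_n) almost nondecreasing, so they
    converge, and then the gaps bound the distances. The error term e admits
    perturbations of exact orthogonality. *)
Lemma energy_gap_cauchy (w : nat -> H) (B : R) :
  (forall n, scalar_re (a (w n) (w n)) <= B) ->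
  (forall e : R, 0 < e -> exists N, forall l m, (N <= l <= m)%N ->
     scalar_re (a (w m - w l) (w m - w l)) <=
     scalar_re (a (w m) (w m)) - scalar_re (a (w l) (w l)) + e) ->
  forall e : R, 0 < e -> exists N, forall l m, (N <= l <= m)%N ->
     nrm (w m - w l) < e.
Proof.
move=> wB wI e e0.
have d0 : 0 < alpha * e ^+ 2 / 3 by rewrite divr_gt0// mulr_gt0// exprn_gt0.
have [|N1 xC] := almost_nondecreasing_cauchy wB _ d0.
  move=> r r0; have [N wN] := wI _ r0; exists N => l m lm.
  by have := wN _ _ lm; have := energy_ge0 alpha_gt0 a_ell (w m - w l); lra.
have [N2 wC] := wI _ d0.
exists (maxn N1 N2) => l m; rewrite geq_max => /andP[/andP[N1l N2l] lm].
have := xC l m; rewrite N1l lm => /(_ isT) h1.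
have := wC l m; rewrite N2l lm => /(_ isT) h2.
have h3 : alpha * nrm (w m - w l) ^+ 2 < alpha * e ^+ 2.
  have := a_ell (w m - w l).
  by move: d0 h1 h2; lra.
by move: h3; rewrite ltr_pM2l// ltr_pXn2r// nnegrE ?nrm_ge0 ?ltW.
Qed.

Variables (M : R) (M_gt0 : 0 < M).
Hypothesis a_bounded : forall v w : H, nrm (a v w : K) <= M * nrm v * nrm w.

Variables (X : nat -> set H).
Hypothesis X_fin : forall l, finite_dim_subspace (X l).
Hypothesis X_mono : forall l m, (l <= m)%N -> X l `<=` X m.
Local Notation Y := (closure (\bigcup_l X l)).

(** The Galerkin solutions w_l of a(w_l, V) = g(V) are bounded by ellipticity,
    and w_m - w_l is a-orthogonal to w_l for l <= m. Hence they converge, and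
    their limit represents g on every X_l, hence on the closure. *)
Lemma riesz_closure (g : H -> K) (C : R) :
  antilinear g -> (forall v, nrm (g v : K) <= C * nrm v) ->
  exists2 w, Y w & forall v, Y v -> a w v = g v.
Proof.
move=> gL gC.
have /choice[w wP] : forall l, exists w, X l w /\ forall v, X l v -> a w v = g v.
  move=> l; have aD := energy_definite alpha_gt0 a_ell.
  have [w wX|w wX wg] := galerkin_exists aS aD aS (X_fin l) _ gL.
    by move=> /(_ w wX); exact: aD.
  by exists w.
have wX l : X l (w l) by have [] := wP l.
have wg l v : X l v -> a (w l) v = g v by have [_] := wP l; exact.
have w_bound n : nrm (w n) <= `|C| / alpha.
  rewrite ler_pdivlMr// mulrC.
  have [->|wn0] := eqVneq (w n) 0; first by rewrite nrm_zero mulr0.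
  have nw := nrm_gt0 wn0; rewrite -(ler_pM2r nw) -mulrA -expr2.
  apply: le_trans (a_ell _) _; rewrite wg//.
  apply: le_trans (scalar_re_le_nrm _) _; apply: le_trans (gC _) _.
  by rewrite ler_wpM2r ?nrm_ge0// ler_norm.
have w_cauchy := @energy_gap_cauchy w (M * (`|C| / alpha) * (`|C| / alpha)).
have [||z zP] := nrm_cauchy_cvg (w_cauchy _ _).
- move=> n; apply: le_trans (scalar_re_le_nrm _) _.
  apply: le_trans (a_bounded _ _) _.
  have nw := nrm_ge0 (w n).
  by rewrite -mulrA -[leRHS]mulrA ler_pM2l// ler_pM.
- exists 0%N => l m /= lm; rewrite hermitian_reB.
  have -> : a (w m - w l) (w l) = 0.
    rewrite (sesquiBl aS) !wg ?subrr//; exact: X_mono (wX l).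
  by rewrite -(of_real0 R k) re_of_real; lra.
have Yz : Y z.
  apply/nrm_closure => e /zP[N zN]; exists (w N); last exact: zN.
  by exists N.
exists z => // v Yv; apply/eqP; rewrite -subr_eq0; apply/eqP.
apply: (antilinear_vanish_closure (C := M * nrm z + C)
  (antilinear_diff (aS.2 z) gL)) Yv.
  move=> x; apply: le_trans (nrmD _ _) _; rewrite nrmN mulrDl.
  exact: lerD.
move=> x [l _ Xx]; apply: (@nrm_eq0 R k K); apply/eqP; apply: contraT => n0.
have n1 : 0 < nrm (a z x - g x : K) by rewrite lt_def n0 nrm_ge0.
have c0 : 0 < M * nrm x + 1 by rewrite ltr_wpDl ?mulr_ge0 ?nrm_ge0// ltW.
have [N zN] := zP _ (divr_gt0 n1 c0).
have := zN (maxn N l) (leq_maxl _ _); set i := maxn N l.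
have gx : g x = a (w i) x by rewrite wg//; exact: (X_mono (leq_maxr N l)).
rewrite ltr_pdivlMr// gx -(sesquiBl aS) => h.
have := a_bounded (z - w i) x; have := nrm_ge0 (z - w i).
lra.
Qed.

End Riesz.

(** * Compact operators into the antidual *)

Section Compact.
Variables (R : realType) (k : scalars) (H : normedModType (base_field R k)).
Local Notation K := (base_field R k).

Lemma pairing_le (g : antidual H) (v : H) : nrm (g v : K) <= nrm g * nrm v.
Proof.
have gE : nrm g = op_norm g by rewrite /nrm antidual_normE re_of_real.
have [->|v0] := eqVneq v 0.
  by rewrite (antilinear0 (antidual_linear g)) !nrm_zero mulr0.
have nv := nrm_gt0 v0.
have vi := nrm_of_real_inv v.
have : nrm (g (of_real k (nrm v)^-1 *: v) : K) <= op_norm g.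
  by apply: op_norm_ge; rewrite nrmZ vi mulVf// gt_eqF.
by rewrite antidualZ conj_of_real nrmM vi mulrC ler_pdivrMr// gE.
Qed.

Variables (Kop : {linear H -> antidual H}) (Kop_compact : compact_operator Kop).

Lemma nrm_ball_bounded : bounded_set [set v : H | nrm v <= 1].
Proof.
exists 1; split; first exact: real1.
move=> x x1 v /= v1; apply: le_trans (ltW x1).
by rewrite -(of_real1 R k) -of_real_nrm ler_of_real.
Qed.

Lemma compact_operator_cluster (w : nat -> H) : (forall n, nrm (w n) <= 1) ->
  exists g : antidual H, forall N (e : R), 0 < e ->
    exists2 n, (N <= n)%N & nrm (Kop (w n) - g) < e.
Proof.
move=> w1; have := Kop_compact nrm_ball_bounded; rewrite precompactE => Kc.
have [|g [_ gP]] := Kc ((Kop \o w) @ \oo) _.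
  by exists 0%N => // n _ /=; apply: subset_closure; exists (w n) => //=.
exists g => N e e0.
have [||_ [[n /= Nn <-] gn]] := gP [set Kop (w n) | n in [set n | (N <= n)%N]]
  (ball g (of_real k e)).
- by exists N => // n /= Nn; exists n.
- by apply: nbhsx_ballx; rewrite of_real_gt0.
exists n => //; rewrite nrmBC nrm_lt; move: gn; by rewrite -ball_normE.
Qed.

Lemma compact_operator_bounded :
  exists2 C, 0 < C & forall v, nrm (Kop v) <= C * nrm v.
Proof.
have [n nP] : exists n : nat, forall v, nrm v <= 1 -> nrm (Kop v) <= n%:R.
  apply: contrapT => /forallNP unb.
  have /choice[w wP] : forall n : nat, exists w,
      nrm w <= 1 /\ n%:R < nrm (Kop w).
    move=> n; have /existsNP[w /not_implyP[w1 /negP]] := unb n.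
    by rewrite -ltNge; exists w.
  have [g gP] := compact_operator_cluster (fun n => (wP n).1).
  have g1 : 0 <= nrm g + 1 by rewrite addr_ge0 ?nrm_ge0.
  have [n bn ng] := gP (Num.bound (nrm g + 1)) 1 ltr01.
  have := archi_boundP g1; have := (wP n).2.
  have := nrmD (Kop (w n) - g) g; rewrite subrK.
  by move: bn; rewrite -(ler_nat R); lra.
exists (n%:R + 1) => [|v]; first by rewrite ltr_wpDl.
have [->|v0] := eqVneq v 0; first by rewrite linear0 !nrm_zero mulr0.
have nv := nrm_gt0 v0.
have vi := nrm_of_real_inv v.
have := nP (of_real k (nrm v)^-1 *: v).
rewrite linearZ !nrmZ vi mulVf ?gt_eqF// lexx => /(_ isT).
by rewrite mulrC ler_pdivrMr//; lra.
Qed.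

End Compact.

(** * Compact perturbations of an elliptic form *)

Section CompactPerturbation.
Variables (R : realType) (k : scalars) (H : completeNormedModType (base_field R k)).
Local Notation K := (base_field R k).
Variables (a : {hermitian_sym H for @scalar_conj R k}).
Variables (alpha : R) (alpha_gt0 : 0 < alpha).
Hypothesis a_ell : forall v : H, alpha * nrm v ^+ 2 <= scalar_re (a v v).
Variables (M : R) (M_gt0 : 0 < M).
Hypothesis a_bounded : forall v w : H, nrm (a v w : K) <= M * nrm v * nrm w.
Variables (Kop : {linear H -> antidual H}) (Kop_compact : compact_operator Kop).
Variables (X : nat -> set H).
Hypothesis X_fin : forall l, finite_dim_subspace (X l).
Hypothesis X_mono : forall l m, (l <= m)%N -> X l `<=` X m.
Local Notation Y := (closure (\bigcup_l X l)).
Hypothesis b_definite : definite_on a Kop Y.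
Local Notation b := (bform a Kop).
Let aS := hermitian_sesquilinear a.

Lemma bform_sesquilinear : sesquilinear b.
Proof.
split=> [x c v w|v c w x]; rewrite /bform.
  rewrite aS.1 linearP -[X in _ + X]/(c * Kop v x + Kop w x) mulrDr.
  by rewrite addrACA.
by rewrite aS.2 (antidual_linear (Kop v)) mulrDr addrACA.
Qed.
Let bS := bform_sesquilinear.

Lemma subspace_closure l v : X l v -> Y v.
Proof. by move=> Xv; apply: subset_closure; exists l. Qed.

(** A counterexample sequence w_n, normalised to |w_n| <= 1, has a cluster point
    g of the K w_n. With z representing -g with respect to a, the identity
    K z = g makes z a solution of the homogeneous problem on Y, so z = 0 and
    g = 0, although |K w_n| > e for all n. *)
Lemma compact_part_small (e : R) : 0 < e -> exists n : nat, forall w, Y w ->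
  (forall v, X n v -> nrm (b w v : K) <= n.+1%:R^-1 * nrm w * nrm v) ->
  nrm (Kop w) <= e * nrm w.
Proof.
move=> e0; apply: contrapT => /forallNP neg.
have /choice[w wP] : forall n : nat, exists w, [/\ Y w, nrm w <= 1,
    forall v, X n v -> nrm (b w v : K) <= n.+1%:R^-1 * nrm v
    & e < nrm (Kop w)].
  move=> n; have /existsNP[w /not_implyP[Yw /not_implyP[bw /negP]]] := neg n.
  rewrite -ltNge => Kw.
  have w0 : w != 0.
    by apply: contraTneq Kw => ->; rewrite linear0 !nrm_zero mulr0 ltxx.
  have nw := nrm_gt0 w0.
  have vi := nrm_of_real_inv w.
  have Y0 : Y 0 by apply: (@subspace_closure 0%N); exact: finite_dim_subspace0.
  exists (of_real k (nrm w)^-1 *: w); split.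
  - by rewrite -[X in Y X]addr0; exact: closure_lin.
  - by rewrite nrmZ vi mulVf// gt_eqF.
  - move=> v Xv; rewrite (sesquiZl bS) nrmM vi mulrC ler_pdivrMr//.
    by apply: le_trans (bw v Xv) _; rewrite mulrAC.
  - by rewrite linearZ nrmZ vi mulrC ltr_pdivlMr.
have [g gP] := compact_operator_cluster Kop_compact
  (fun n => let: And4 _ w1 _ _ := wP n in w1).
have [C C0 KC] := compact_operator_bounded Kop_compact.
have [z Yz zg] : exists2 z, Y z & forall v, Y v -> a z v = - g v.
  apply: (riesz_closure alpha_gt0 a_ell M_gt0 a_bounded X_fin X_mono
    (g := fun v => - g v) (C := nrm g)).
    by move=> c x y; rewrite (antidual_linear g) opprD mulrN.
  by move=> v; rewrite nrmN; exact: pairing_le.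
(* For fixed x let y represent v |-> <K v, x>. Then <K w_n, x> = a(w_n, y), which
   is close to -g(y) = a(z, y) = <K z, x>, because w_n is almost b-orthogonal to
   the approximations v of y in X_l. *)
have Kz : Kop z = g.
  apply/val_inj/funext => x /=.
  have [y Yy yx] : exists2 y, Y y & forall v, Y v -> a y v = scalar_conj (Kop v x).
    apply: (riesz_closure alpha_gt0 a_ell M_gt0 a_bounded X_fin X_mono
      (g := fun v => scalar_conj (Kop v x)) (C := C * nrm x)).
      move=> c v v'; rewrite linearP -[X in scalar_conj X]/(c * Kop v x + Kop v' x).
      by rewrite scalar_conjD scalar_conjM.
    move=> v; rewrite nrm_conj mulrAC; apply: le_trans (pairing_le _ _) _.
    by rewrite ler_wpM2r ?nrm_ge0.
  have ay v : Y v -> a v y = Kop v x.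
    by move=> Yv; rewrite hermitian_conj yx// scalar_conjK.
  rewrite -ay// zg//; apply/eqP; rewrite eq_sym -addr_eq0; apply/eqP.
  apply: (@nrm_eq0 R k K); apply/le_anti; rewrite nrm_ge0 andbT.
  apply/ler_addgt0Pl => d d0; rewrite addr0.
  have d4 : 0 < d / 4 by rewrite divr_gt0.
  have Mg : 0 < M + nrm g by rewrite ltr_wpDr ?nrm_ge0.
  have [v [l _ Xv] yv] := (nrm_closure _ y).1 Yy _ (divr_gt0 d4 Mg).
  have xv : 0 < nrm x + nrm v + 1 by rewrite ltr_wpDl ?addr_ge0 ?nrm_ge0.
  have [n ln ng] := gP (maxn l (Num.bound (nrm v / (d / 4)))) _ (divr_gt0 d4 xv).
  have [Yw w1 bw _] := wP n; move: ln; rewrite geq_max => /andP[ln vn].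
  have -> : g x + g y = (g x - Kop (w n) x) +
     (a (w n) (y - v) + b (w n) v + (g v - Kop (w n) v) + g (y - v)).
    rewrite (sesquiBr aS) ay// (antilinearB (antidual_linear g)) /bform.
    by ring.
  have B1 : nrm (g x - Kop (w n) x : K) <= nrm (Kop (w n) - g) * nrm x.
    by rewrite nrmBC -[X in nrm (X : K)]/((Kop (w n) - g) x) pairing_le.
  have B2 : nrm (g v - Kop (w n) v : K) <= nrm (Kop (w n) - g) * nrm v.
    by rewrite nrmBC -[X in nrm (X : K)]/((Kop (w n) - g) v) pairing_le.
  have B3 : nrm (g (y - v) : K) <= nrm g * nrm (y - v) by exact: pairing_le.
  have B4 : nrm (a (w n) (y - v) : K) <= M * nrm (y - v).
    apply: le_trans (a_bounded _ _) _.
    by rewrite ler_wpM2r ?nrm_ge0// ger_pMr.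
  have B5 : nrm (b (w n) v : K) <= d / 4.
    apply: le_trans (bw _ (X_mono ln Xv)) _.
    rewrite mulrC ler_pdivrMr// mulrC -ler_pdivrMr//.
    apply: le_trans (ltW (archi_boundP _)) _; first by rewrite divr_ge0 ?nrm_ge0 ?ltW.
    by rewrite ler_nat ltnW.
  move: yv ng; rewrite !ltr_pdivlMr// => yv ng.
  have := nrmD (g x - Kop (w n) x : K)
     (a (w n) (y - v) + b (w n) v + (g v - Kop (w n) v) + g (y - v)).
  have := nrmD (a (w n) (y - v) + b (w n) v + (g v - Kop (w n) v) : K) (g (y - v)).
  have := nrmD (a (w n) (y - v) + b (w n) v : K) (g v - Kop (w n) v).
  have := nrmD (a (w n) (y - v) : K) (b (w n) v).
  have := nrm_ge0 (Kop (w n) - g).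
  by lra.
have z0 : z = 0.
  by apply: b_definite => // v Yv; rewrite /bform zg// Kz addNr.
have [n _] := gP 0%N e e0; rewrite -Kz z0 linear0 subr0.
by have [_ _ _ eK] := wP n; move=> /(lt_trans eK); rewrite ltxx.
Qed.

(** Galerkin orthogonality to X_l implies orthogonality to X_n for n <= l, so one
    index serves all later levels. *)
Lemma compact_part_small_orthogonal (e : R) : 0 < e ->
  exists n : nat, forall l w, (n <= l)%N -> Y w ->
    (forall v, X l v -> b w v = 0) -> nrm (Kop w) <= e * nrm w.
Proof.
move=> e0; have [n nP] := compact_part_small e0.
exists n => l w nl Yw bw; apply: nP => // v /(X_mono nl)/bw ->.
by rewrite nrm_zero !mulr_ge0 ?nrm_ge0.
Qed.

(** On a solution w of the homogeneous problem, ellipticity gives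
    alpha |w|^2 <= |K w| |w|, against |K w| <= (alpha / 2) |w|. *)
Lemma discrete_definite : exists n : nat, forall l, (n <= l)%N ->
  definite_on a Kop (X l).
Proof.
have [n nP] := compact_part_small_orthogonal (divr_gt0 alpha_gt0 (ltr0n _ 2)).
exists n => l nl w Xw bw; apply: nrm_eq0; apply/eqP; apply: contraT => nw0.
have nw : 0 < nrm w by rewrite lt_def nw0 nrm_ge0.
have Kw := nP l w nl (subspace_closure Xw) bw.
have := congr1 scalar_re (bw w Xw).
rewrite /bform scalar_reD -(of_real0 R k) re_of_real => bww.
have := scalar_re_le_nrm (- Kop w w); rewrite nrmN scalar_reN.
have := pairing_le (Kop w) w; have := a_ell w.
have : nrm (Kop w) * nrm w <= alpha / 2 * nrm w * nrm w.
  by rewrite ler_wpM2r ?nrm_ge0.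
have : 0 < alpha * nrm w ^+ 2 by rewrite mulr_gt0// exprn_gt0.
rewrite -mulrA -expr2; lra.
Qed.

Variable f : antidual H.

Lemma discrete_well_posed : exists n : nat, forall l, (n <= l)%N ->
  exists U, unique_discrete_solution a Kop f (X l) U.
Proof.
have [n nP] := discrete_definite; exists n => l nl.
have [|U XU Uf] := galerkin_exists aS (energy_definite alpha_gt0 a_ell) bS
  (X_fin l) _ (antidual_linear f).
  exact: nP.
exists U; split=> // U' [XU' U'f].
apply/eqP; rewrite -subr_eq0; apply/eqP; apply: (nP l nl).
  exact: finite_dim_subspaceB.
by move=> v Xv; rewrite (sesquiBl bS) Uf// U'f// subrr.
Qed.

Variables (U : nat -> H) (n0 : nat).
Hypothesis U_discrete : forall l, (n0 <= l)%N -> discrete_solution a Kop f (X l) (U l).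

(** If U_l is large compared with f, then b(U_l, .) = f is small relative to
    U_l, so the compact part is negligible and ellipticity bounds U_l. *)
Lemma discrete_bounded : exists (n : nat) (B : R), (n0 <= n)%N /\
  forall l, (n <= l)%N -> nrm (U l) <= B.
Proof.
have [n nP] := compact_part_small (divr_gt0 alpha_gt0 (ltr0n _ 2)).
exists (maxn n0 n), (nrm f * n.+1%:R + 2 * nrm f / alpha).
split=> [|l]; first exact: leq_maxl.
rewrite geq_max => /andP[n0l nl]; have [XU Uf] := U_discrete n0l.
have nf := nrm_ge0 f; have nU := nrm_ge0 (U l).
have fa : 0 <= 2 * nrm f / alpha by rewrite divr_ge0 ?mulr_ge0 // ltW.
have fn : 0 <= nrm f * n.+1%:R by rewrite mulr_ge0.
have [|fU] := leP (nrm (U l)) (nrm f * n.+1%:R); first lra.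
have KU : nrm (Kop (U l)) <= alpha / 2 * nrm (U l).
  apply: nP => [|v Xv]; first exact: subspace_closure XU.
  rewrite (Uf _ (X_mono nl Xv)); apply: le_trans (pairing_le _ _) _.
  rewrite ler_wpM2r ?nrm_ge0// mulrC ler_pdivlMr ?ltr0n//.
  exact: ltW.
have U0 : 0 < nrm (U l) by exact: le_lt_trans fU.
have := congr1 scalar_re (Uf _ XU); rewrite /bform scalar_reD => bUU.
have := scalar_re_le_nrm (- Kop (U l) (U l)); rewrite nrmN scalar_reN.
have := scalar_re_le_nrm (f (U l)).
have := pairing_le (Kop (U l)) (U l); have := pairing_le f (U l).
have := a_ell (U l).
have : nrm (Kop (U l)) * nrm (U l) <= alpha / 2 * nrm (U l) * nrm (U l).
  by rewrite ler_wpM2r ?nrm_ge0.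
move=> h1 h2 h3 h4 h5 h6.
have : alpha / 2 * nrm (U l) * nrm (U l) <= nrm f * nrm (U l).
  by move: h1 h2; rewrite expr2 !mulrA; lra.
rewrite ler_pM2r// => h7.
suff : nrm (U l) <= 2 * nrm f / alpha by lra.
by rewrite ler_pdivlMr//; lra.
Qed.

(** The difference U_m - U_l is b-orthogonal to U_l, and a differs from b by K,
    which is small on such differences; thus its energy is almost the gap of
    the energies of U_m and U_l. *)
Lemma discrete_cauchy (e : R) : 0 < e ->
  exists N, forall l m, (N <= l <= m)%N -> nrm (U m - U l) < e.
Proof.
move=> e0; have [n [B [n0n UB]]] := discrete_bounded.
have B0 : 0 <= B by apply: le_trans (nrm_ge0 (U n)) (UB _ (leqnn n)).
pose w i := U (n + i)%N.
have w_cauchy := @energy_gap_cauchy _ _ _ _ _ alpha_gt0 a_ell w (M * B * B).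
have [||N NP] := w_cauchy _ _ _ e0; last first.
- exists (n + N)%N => l m /andP[nl lm].
  have nl' : (n <= l)%N by exact: leq_trans (leq_addr _ _) nl.
  have := NP (l - n)%N (m - n)%N; rewrite /w !subnKC//; last exact: leq_trans lm.
  by apply; rewrite leq_sub2r// andbT -(leq_add2l n) subnKC.
- move=> d d0; have B1 : 0 < 4 * B ^+ 2 + 1 by rewrite ltr_wpDl ?mulr_ge0 ?sqr_ge0.
  have [n1 n1P] := compact_part_small_orthogonal (divr_gt0 d0 B1).
  exists n1 => i j /andP[n1i ij].
  have nin : (n <= n + i)%N by exact: leq_addr.
  have njn : (n <= n + j)%N by exact: leq_addr.
  have nij : (n + i <= n + j)%N by rewrite leq_add2l.
  have [XUi Ui] := U_discrete (leq_trans n0n nin).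
  have [XUj Uj] := U_discrete (leq_trans n0n njn).
  have orth v : X (n + i)%N v -> b (w j - w i) v = 0.
    by move=> Xv; rewrite (sesquiBl bS) /w Ui// Uj ?subrr//; exact: X_mono Xv.
  have Yij : Y (w j - w i).
    apply: (@subspace_closure (n + j)%N); apply: finite_dim_subspaceB => //.
    exact: X_mono XUi.
  have Ke := n1P (n + i)%N _ (leq_trans n1i (leq_addl _ _)) Yij orth.
  have := congr1 scalar_re (orth _ XUi).
  rewrite /bform scalar_reD -(of_real0 R k) re_of_real hermitian_reB => h1.
  have h2 := scalar_re_le_nrm (Kop (w j - w i) (w i)).
  have h3 := pairing_le (Kop (w j - w i)) (w i).
  have h4 : nrm (w j - w i) <= 2 * B.
    apply: le_trans (nrmD _ _) _; rewrite nrmN.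
    by have := UB _ nin; have := UB _ njn; rewrite /w; lra.
  set c := d / (4 * B ^+ 2 + 1) in Ke *.
  have c0 : 0 < c by rewrite divr_gt0.
  have h5 : nrm (Kop (w j - w i)) * nrm (w i) <= c * (2 * B) * B.
    apply: ler_pM; rewrite ?nrm_ge0//; last exact: UB.
    by apply: le_trans Ke _; rewrite ler_pM2l.
  have h6 : d = c * (4 * B ^+ 2 + 1) by rewrite divfK// gt_eqF.
  by rewrite h6; move: h1 h2 h3 h5; rewrite /w; lra.
- move=> i; apply: le_trans (scalar_re_le_nrm _) _; apply: le_trans (a_bounded _ _) _.
  have := UB _ (leq_addr i n); rewrite -/(w i) => wB.
  by rewrite -mulrA -[leRHS]mulrA ler_pM2l// ler_pM ?nrm_ge0.
Qed.

End CompactPerturbation.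

(** * Quasi-optimality *)

Section QuasiOptimality.
Variables (R : realType) (k : scalars) (H : normedModType (base_field R k)).
Local Notation K := (base_field R k).
Variables (a : {hermitian_sym H for @scalar_conj R k}).
Variables (alpha : R) (alpha_gt0 : 0 < alpha).
Hypothesis a_ell : forall v : H, alpha * nrm v ^+ 2 <= scalar_re (a v v).
Variable (Kop : {linear H -> antidual H}).
Let aS := hermitian_sesquilinear a.

Lemma nrm_energy v w : alpha * (nrm v * nrm w) <= energy_norm a v * energy_norm a w.
Proof.
have E0 x : 0 <= energy_norm a x by exact: sqrtr_ge0.
have l0 : 0 <= alpha * (nrm v * nrm w) by rewrite !mulr_ge0 ?nrm_ge0// ltW.
rewrite -(ler_pXn2r (ltn0Sn 1)) ?nnegrE ?l0 ?mulr_ge0// !exprMn.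
have := a_ell v; have := a_ell w.
rewrite -!(energy_norm_sqr alpha_gt0 a_ell) => hw hv.
have -> : alpha ^+ 2 * (nrm v ^+ 2 * nrm w ^+ 2) =
  (alpha * nrm v ^+ 2) * (alpha * nrm w ^+ 2) by ring.
have a0 := ltW alpha_gt0; by apply: ler_pM; rewrite ?(mulr_ge0 a0 (sqr_ge0 _)).
Qed.

(** Expand a(e, e) as a(e, u - V) + a(e, V - U); by orthogonality the last term
    is - <K e, V - U>, and V - U = e - (u - V). *)
Lemma galerkin_quasi_optimal (A : set H) (u U V : H) (s : R) :
  finite_dim_subspace A -> A U -> A V ->
  (forall W, A W -> bform a Kop (u - U) W = 0) ->
  0 <= s -> nrm (Kop (u - U)) <= s * alpha * nrm (u - U) ->
  (1 - s) * energy_norm a (u - U) <= (1 + s) * energy_norm a (u - V).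
Proof.
move=> Af AU AV orth s0 Ks; set e := u - U in orth Ks *.
have E0 x : 0 <= energy_norm a x by exact: sqrtr_ge0.
have [->|e0] := eqVneq (energy_norm a e) 0.
  by rewrite mulr0 mulr_ge0// addr_ge0.
have Ee : 0 < energy_norm a e by rewrite lt_def e0 E0.
rewrite -(ler_pM2r Ee).
have UV : e - (u - V) = V - U.
  by rewrite /e opprB addrC addrA subrK.
have := congr1 scalar_re (orth (V - U) (finite_dim_subspaceB Af AV AU)).
rewrite /bform scalar_reD -(of_real0 R k) re_of_real => h1.
have h2 := energy_norm_sqr alpha_gt0 a_ell e.
have h3 : scalar_re (a e e) = scalar_re (a e (u - V)) + scalar_re (a e (V - U)).
  by rewrite -scalar_reD -(sesquiDr aS) -UV addrC subrK.
have h4 := energy_cauchy_schwarz alpha_gt0 a_ell e (u - V).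
have := scalar_re_le_nrm (- Kop e (V - U)); rewrite nrmN scalar_reN => h5.
have h6 := pairing_le (Kop e) (V - U).
have h7 : nrm (V - U) <= nrm e + nrm (u - V).
  by rewrite -UV; apply: le_trans (nrmD _ _) _; rewrite nrmN.
have h8 : nrm (Kop e) * nrm (V - U) <= s * alpha * nrm e * (nrm e + nrm (u - V)).
  by apply: ler_pM => //; exact: nrm_ge0.
have h9 : s * (alpha * (nrm e * nrm e)) <= s * (energy_norm a e * energy_norm a e).
  by rewrite ler_wpM2l// nrm_energy.
have h10 : s * (alpha * (nrm e * nrm (u - V))) <=
    s * (energy_norm a e * energy_norm a (u - V)).
  by rewrite ler_wpM2l// nrm_energy.
move: h1 h2 h3 h4 h5 h6 h8 h9 h10; lra.
Qed.

Lemma best_approximation (A : set H) (u : H) : finite_dim_subspace A ->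
  exists2 P, A P & forall V, A V -> energy_norm a (u - P) <= energy_norm a (u - V).
Proof.
move=> Af; have aD := energy_definite alpha_gt0 a_ell.
have [|P AP Pu] := galerkin_exists aS aD aS Af _ (aS.2 u).
  by move=> w Aw /(_ w Aw); exact: aD.
exists P => // V AV; rewrite ler_wsqrtr//.
have -> : u - P = u - V - (P - V).
  by rewrite opprB addrA subrK.
rewrite hermitian_reB; have -> : a (u - V - (P - V)) (P - V) = 0.
  rewrite opprB addrA subrK (sesquiBl aS) Pu ?subrr//.
  exact: finite_dim_subspaceB.
have := energy_ge0 alpha_gt0 a_ell (P - V).
by rewrite -(of_real0 R k) re_of_real; lra.
Qed.

End QuasiOptimality.

(** * Contraction of the estimator *)

Section Estimator.

Lemma perturbed_contraction_cvg0 (R : realType) (x y : nat -> R) (q : R) (n0 : nat) :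
  0 <= q < 1 ->
  (forall n, (n0 <= n)%N -> x n.+1 <= q * x n + y n) ->
  (forall e : R, 0 < e -> exists N, forall n, (N <= n)%N -> y n <= e) ->
  forall e : R, 0 < e -> exists N, forall n, (N <= n)%N -> x n <= e.
Proof.
move=> /andP[q0 q1] xq y0 e e0.
have d0 : 0 < (1 - q) * (e / 2) by rewrite mulr_gt0 ?divr_gt0// subr_gt0.
have [N yN] := y0 _ d0; pose m := maxn n0 N.
have xm i : x (m + i)%N <= q ^+ i * x m + e / 2.
  elim: i => [|i IH]; first by rewrite addn0 expr0 mul1r lerDl divr_ge0// ltW.
  rewrite addnS; apply: le_trans (xq _ _) _.
    exact: leq_trans (leq_maxl _ _) (leq_addr _ _).
  have := yN _ (leq_trans (leq_maxr n0 N) (leq_addr i m)).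
  have := ler_wpM2l q0 IH; rewrite exprS; lra.
have [i iP] : exists i, forall j, (i <= j)%N -> q ^+ j * x m <= e / 2.
  have xm1 : 0 < `|x m| + 1 by rewrite ltr_wpDl.
  have /cvg_expr/cvgrPdist_lt/(_ _ (divr_gt0 (divr_gt0 e0 (ltr0n _ 2)) xm1)) :
    `|q| < 1 by rewrite ger0_norm.
  move=> [i _ iP]; exists i => j ij; have := iP j ij.
  rewrite /= sub0r normrN ger0_norm ?exprn_ge0// ltr_pdivlMr// => qe.
  apply: le_trans (ltW qe); rewrite ler_wpM2l ?exprn_ge0//.
  by have := ler_norm (x m); lra.
exists (m + i)%N => n mn; have mn' := leq_trans (leq_addr i m) mn.
rewrite -(subnKC mn'); apply: le_trans (xm _) _.
have := iP (n - m)%N; rewrite -(leq_add2l m) subnKC// => /(_ mn).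
by lra.
Qed.

Variables (R : realType) (d : nat) (eta : mesh R d -> element R d -> R).
Implicit Types (T P Q : mesh R d).

Lemma estimator_on_sqr T P : estimator_on eta T P ^+ 2 = \sum_(E <- P) eta T E ^+ 2.
Proof. by rewrite sqr_sqrtr// sumr_ge0// => E _; exact: sqr_ge0. Qed.

Lemma estimator_on_split T P Q :
  estimator_on eta T P ^+ 2 =
  estimator_on eta T (Q `&` P)%fset ^+ 2 + estimator_on eta T (P `\` Q)%fset ^+ 2.
Proof.
rewrite !estimator_on_sqr (big_fsetID _ (mem Q)) /=; congr (_ + _);
  apply: eq_fbigl => E; rewrite !inE //= andbC //.
Qed.

Lemma estimator_on_subset T P Q : (P `<=` Q)%fset ->
  estimator_on eta T P ^+ 2 <= estimator_on eta T Q ^+ 2.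
Proof.
move=> /fsetIidPl PQ; rewrite (estimator_on_split T Q P) PQ.
by rewrite lerDl sqr_ge0.
Qed.

(** Young's inequality turns stability into a bound with factor 1 + delta on the
    elements in both meshes, while the marked share theta of the
    squared estimator is reduced by q. The gain (1 - q) theta is split evenly:
    delta is half of it, which leaves the factor 1 - delta. *)
Lemma doerfler_contraction (theta q C D : R) : 0 < theta <= 1 -> 0 < q < 1 ->
  exists rho c, 0 <= rho < 1 /\ 0 < c /\
  forall T T' M (t : R), 0 <= t -> Doerfler eta theta T M ->
    (M `<=` T `\` T')%fset ->
    `|estimator_on eta T' (T' `&` T)%fset - estimator_on eta T (T' `&` T)%fset|
      <= C * t ->
    estimator_on eta T' (T' `\` T)%fset ^+ 2
      <= q * estimator_on eta T (T `\` T')%fset ^+ 2 + D ^+ 2 * t ^+ 2 ->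
    estimator eta T' ^+ 2 <= rho * estimator eta T ^+ 2 + c * t ^+ 2.
Proof.
move=> /andP[th0 th1] /andP[q0 q1].
pose delta := (1 - q) * theta / 2.
have q10 : 0 < 1 - q by rewrite subr_gt0.
have delta0 : 0 < delta by rewrite divr_gt0// mulr_gt0.
have delta1 : delta < 1.
  rewrite ltr_pdivrMr// mul1r; have : (1 - q) * theta <= (1 - q) * 1.
    by rewrite ler_pM2l.
  by lra.
exists (1 - delta), (C ^+ 2 + C ^+ 2 / delta + D ^+ 2 + 1); split; first lra.
split.
  have : 0 <= C ^+ 2 / delta by rewrite divr_ge0 ?sqr_ge0// ltW.
  by have := sqr_ge0 C; have := sqr_ge0 D; lra.
move=> T T' M t t0 [_ MT] MTT' stab red.
rewrite /estimator (estimator_on_split T' T' T) (estimator_on_split T T T').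
move: MT; rewrite /estimator (estimator_on_split T T T') => MT.
have := le_trans MT (estimator_on_subset _ MTT').
rewrite [(T `&` T')%fset]fsetIC.
move: stab red; set s' := estimator_on eta T' _; set s := estimator_on eta T _.
set r := estimator_on eta T _ => stab red mark.
have s0 : 0 <= s by exact: sqrtr_ge0.
have s'0 : 0 <= s' by exact: sqrtr_ge0.
have s's : s' <= s + C * t by move: stab; rewrite ler_norml; lra.
have h1 : s' ^+ 2 <= (s + C * t) ^+ 2 by rewrite ler_pXn2r ?nnegrE//; lra.
(* Young's inequality for 2 s (C t). *)
have h2 : 0 <= (delta * s - C * t) ^+ 2 / delta.
  by rewrite divr_ge0 ?sqr_ge0// ltW.
have h3 : (delta * s - C * t) ^+ 2 / delta =
    delta * s ^+ 2 - 2 * (s * (C * t)) + (C * t) ^+ 2 / delta.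
  by field; rewrite gt_eqF.
have h4 : (1 - q) * (theta * (s ^+ 2 + r ^+ 2)) <= (1 - q) * r ^+ 2.
  by rewrite ler_pM2l.
have h5 : delta * r ^+ 2 >= 0 by rewrite mulr_ge0 ?sqr_ge0// ltW.
have h6 : delta * (s ^+ 2 + r ^+ 2) = (1 - q) * (theta * (s ^+ 2 + r ^+ 2)) / 2.
  by rewrite /delta; ring.
have t2 := sqr_ge0 t.
move: h1 h2 h3; rewrite sqrrD !exprMn => h1 h2 h3.
set cd := C ^+ 2 / delta.
have h7 : C ^+ 2 * t ^+ 2 / delta = cd * t ^+ 2 by rewrite /cd mulrAC.
move: h1 h2 h3; rewrite h7 mulr2n; lra.
Qed.

End Estimator.

(** * The adaptive algorithm *)

Section Adaptivity.
Variables (R : realType) (k : scalars) (H : normedModType (base_field R k)).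
Variables (a : {hermitian_sym H for @scalar_conj R k}).
Variables (Kop : {linear H -> antidual H}) (f : antidual H).
Variables (d : nat) (Omega : set 'rV[R]_d) (S : refinement_strategy Omega).
Variables (T0 : mesh R d) (T0_conforming : conforming_triangulation Omega T0).
Variables (X : mesh R d -> set H) (eta : mesh R d -> element R d -> R).
Variables (theta Cmark : R) (theta_range : 0 < theta <= 1).
Variables (T : nat -> mesh R d) (U : nat -> H) (est : nat -> R).
Hypothesis output : adaptive_output a Kop f S T0 X eta theta Cmark T U est.

Lemma adaptive_step l :
  exists2 M, (M `<=` T l)%fset & T l.+1 = refine S (T l) M.
Proof.
have [_ /(_ l)[[_ _ _ TM]|[_ _ [M [[[MT _] _] TM]]]]] := output.
  by exists (T l).
by exists M.
Qed.

Lemma adaptive_refined l : refined S T0 (T l).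
Proof.
elim: l => [|l IH]; first by rewrite output.1; exact: refined_refl.
by have [M MT ->] := adaptive_step l; exact: refined_step.
Qed.

Lemma adaptive_refined_succ l : refined S (T l) (T l.+1).
Proof.
have [M MT ->] := adaptive_step l.
by apply: refined_step => //; exact: refined_refl.
Qed.

Lemma adaptive_conforming l : conforming_triangulation Omega (T l).
Proof.
elim: l => [|l IH]; first by rewrite output.1.
by have [M MT ->] := adaptive_step l; have [[]] := refineP S IH MT.
Qed.

Lemma adaptive_spaces_mono : nested_spaces S T0 X ->
  forall l m, (l <= m)%N -> X (T l) `<=` X (T m).
Proof.
move=> [_ Xmono] l m lm; rewrite -(subnKC lm).
elim: (m - l)%N => [|i IH]; first by rewrite addn0.
rewrite addnS; apply: subset_trans IH _.
by apply: Xmono; [exact: adaptive_refined|exact: adaptive_refined_succ].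
Qed.

Lemma adaptive_solution l :
  (exists W, unique_discrete_solution a Kop f (X (T l)) W) ->
  unique_discrete_solution a Kop f (X (T l)) (U l).
Proof. by move=> ex; have [_ /(_ l)[[]|[]]] := output. Qed.

Lemma adaptive_estimator_cvg0 (n0 : nat) :
  stability a Kop f S T0 X eta -> reduction a Kop f S T0 X eta ->
  (forall l, (n0 <= l)%N -> unique_discrete_solution a Kop f (X (T l)) (U l)) ->
  (forall e : R, 0 < e -> exists N, forall l m, (N <= l <= m)%N ->
     nrm (U m - U l) < e) ->
  forall e : R, 0 < e -> exists N, forall l, (N <= l)%N -> estimator eta (T l) <= e.
Proof.
move=> [C [C0 stab]] [D [q [D0 [q01 red]]]] sol UC e e0.
have [rho [c [rho01 [c0 contr]]]] := doerfler_contraction eta C D theta_range q01.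
have step n : (n0 <= n)%N -> estimator eta (T n.+1) ^+ 2 <=
    rho * estimator eta (T n) ^+ 2 + c * nrm (U n.+1 - U n) ^+ 2.
  move=> n0n; have Un := sol n n0n; have Un1 := sol n.+1 (leqW n0n).
  have [_ /(_ n)[[[]]|[_ _ [M [[DM _] TM]]]]] := output; first by exists (U n).
  apply: (contr _ _ M); rewrite ?nrm_ge0//.
  - have [[_ _ _]] := refineP S (adaptive_conforming n) DM.1.
    by rewrite -TM.
  - by apply: stab => //; [exact: adaptive_refined|exact: adaptive_refined_succ].
  - by apply: red => //; [exact: adaptive_refined|exact: adaptive_refined_succ].
have e2 : 0 < e ^+ 2 by rewrite exprn_gt0.
have [|N NP] := perturbed_contraction_cvg0 rho01 step _ e2.
  move=> r r0; have rc : 0 < Num.sqrt (r / c) by rewrite sqrtr_gt0 divr_gt0.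
  have [N NP] := UC _ rc; exists N => n Nn.
  have := NP n n.+1; rewrite Nn leqnSn => /(_ isT)/ltW.
  rewrite -(ler_pXn2r (ltn0Sn 1)) ?nnegrE ?nrm_ge0 ?sqrtr_ge0//.
  by rewrite sqr_sqrtr ?(ltW (divr_gt0 r0 c0))// ler_pdivlMr// mulrC.
exists N => l /NP; rewrite ler_pXn2r ?nnegrE ?sqrtr_ge0//; exact: ltW.
Qed.

End Adaptivity.

Theorem theorem20
  (R : realType) (k : scalars)
  (* the separable Hilbert space *)
  (H : completeNormedModType (base_field R k))
  (ip : {dot H for @scalar_conj R k})
  (ip_norm : forall v : H, `|v| ^+ 2 = ip v v)
  (H_separable : exists D : set H, countable D /\ dense D)
  (* the model problem *)
  (a : {hermitian_sym H for @scalar_conj R k})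
  (a_continuous : continuous (fun p : H * H => a p.1 p.2))
  (a_elliptic : elliptic a)
  (Kop : {linear H -> antidual H})
  (Kop_compact : compact_operator Kop)
  (f : antidual H)
  (b_well_posed : well_posed a Kop)
  (u : H)
  (u_solution : forall v : H, bform a Kop u v = f v)
  (* meshes and discrete spaces *)
  (d : nat) (d_ge2 : (2 <= d)%N)
  (Omega : set 'rV[R]_d)
  (Omega_domain : polyhedral_Lipschitz_domain Omega)
  (S : refinement_strategy Omega)
  (T0 : mesh R d)
  (T0_conforming : conforming_triangulation Omega T0)
  (h_reduction : mesh_size_reduction S T0)
  (X : mesh R d -> set H)
  (X_nested : nested_spaces S T0 X)
  (X_dense : uniform_density S T0 X)
  (* the error estimator *)
  (eta : mesh R d -> element R d -> R)
  (eta_ge0 : nonneg_indicators a Kop f S T0 X eta)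
  (eta_stability : stability a Kop f S T0 X eta)
  (eta_reduction : reduction a Kop f S T0 X eta)
  (eta_reliability : reliability a Kop f S T0 X eta u)
  (eta_discrete_reliability : discrete_reliability a Kop f S T0 X eta)
  (* the output of the adaptive algorithm *)
  (theta Cmark : R)
  (theta_range : 0 < theta <= 1)
  (Cmark_ge1 : 1 <= Cmark)
  (T : nat -> mesh R d) (U : nat -> H) (est : nat -> R)
  (T_U_est_output : adaptive_output a Kop f S T0 X eta theta Cmark T U est)
  (b_definite : definite_on a Kop (limit_space X T)) :
  exists (C : nat -> R) (l4 : nat),
    [/\ forall l, 1 <= C l,
        C @ \oo --> (1 : R),
        (0 < l4)%N
      & forall l, (l4 <= l)%N ->
          exists m : R,
            [/\ [set energy_norm a (u - V) | V in X (T l)] m,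
                lbound [set energy_norm a (u - V) | V in X (T l)] m
              & energy_norm a (u - U l) <= C l * m]].
Proof.
have [alpha [alpha_gt0 a_ell]] := a_elliptic.
have [M M_gt0 a_bounded] := sesquilinear_bounded (hermitian_sesquilinear a) a_continuous.
have out := T_U_est_output.
have T_ref := adaptive_refined out.
have X_fin l : finite_dim_subspace (X (T l)) by exact: X_nested.1 (T_ref l).
have X_mono := adaptive_spaces_mono out X_nested.
pose Y := closure (\bigcup_l X (T l)).
have [n0 n0P] := discrete_well_posed alpha_gt0 a_ell M_gt0 a_bounded Kop_compact
  X_fin X_mono b_definite f.
have U_sol l : (n0 <= l)%N -> unique_discrete_solution a Kop f (X (T l)) (U l).
  by move=> /n0P; exact: (adaptive_solution out).
have XU l : (n0 <= l)%N -> X (T l) (U l) by move=> /U_sol[[]].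
have U_cauchy e := @discrete_cauchy _ _ _ _ _ alpha_gt0 a_ell _ M_gt0 a_bounded _
  Kop_compact _ X_fin X_mono b_definite f U n0 (fun l nl => (U_sol l nl).1) e.
have est0 := adaptive_estimator_cvg0 T0_conforming theta_range out eta_stability
  eta_reduction U_sol U_cauchy.
have [Crel [Crel_gt0 rel]] := eta_reliability.
have Yu : Y u.
  apply/nrm_closure => e e0.
  have e1 : 0 < e / Crel / 2 by rewrite !divr_gt0.
  have [N NP] := est0 _ e1; exists (U (maxn n0 N)).
    by exists (maxn n0 N) => //; apply: XU; exact: leq_maxl.
  apply: le_lt_trans (rel _ _ (T_ref _) (U_sol _ (leq_maxl n0 N))) _.
  rewrite mulrC -ltr_pdivlMr//; apply: le_lt_trans (NP _ (leq_maxr _ _)) _.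
  by rewrite ltr_pdivrMr// ltr_pMr ?ltr1n// divr_gt0.
have Ye l : (n0 <= l)%N -> Y (u - U l).
  move=> nl; rewrite addrC -scaleN1r; apply: closure_lin => //.
  by apply: subset_closure; exists l => //; exact: XU.
have orth l : (n0 <= l)%N -> forall V, X (T l) V -> bform a Kop (u - U l) V = 0.
  move=> nl V XV; rewrite (sesquiBl (bform_sesquilinear a Kop)) u_solution.
  by rewrite (U_sol l nl).1.2 ?subrr.
(* If U_l = u, the quotient is 0 / 0 = 0, which is the right value. *)
pose s l := nrm (Kop (u - U l)) / (alpha * nrm (u - U l)).
have s_ge0 l : 0 <= s l by rewrite divr_ge0 ?mulr_ge0 ?nrm_ge0// ltW.
have s_small e : 0 < e -> exists N, forall l, (N <= l)%N -> s l <= e.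
  move=> e0; have [N NP] := compact_part_small_orthogonal alpha_gt0 a_ell M_gt0
    a_bounded Kop_compact X_fin X_mono b_definite (mulr_gt0 e0 alpha_gt0).
  exists (maxn n0 N) => l; rewrite geq_max => /andP[nl Nl].
  have Ke := NP l _ Nl (Ye l nl) (orth l nl).
  have [e00|e00] := eqVneq (u - U l) 0.
    by rewrite /s e00 nrm_zero mulr0 invr0 mulr0 ltW.
  by rewrite ler_pdivrMr ?mulr_gt0 ?nrm_gt0// mulrA.
have sE l : nrm (Kop (u - U l)) <= s l * alpha * nrm (u - U l).
  have [e00|e00] := eqVneq (u - U l) 0; first by rewrite e00 linear0 !nrm_zero mulr0.
  by rewrite -mulrA divfK// mulf_neq0 ?gt_eqF// nrm_gt0.
have half_gt0 : 0 < 2^-1 :> R by rewrite invr_gt0.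
have [N NP] := s_small _ half_gt0.
(* (1 + s) / (1 - s) <= 1 + 4 s as soon as s <= 1/2; the right-hand side is at
   least 1 also on the early levels, where s may be large. *)
exists (fun l => 1 + 4 * s l), (maxn n0 N).+1; split=> //.
- by move=> l; rewrite lerDl mulr_ge0.
- apply/cvgrPdist_le => e e0; have e4 : 0 < e / 4 by rewrite divr_gt0.
  have [N' N'P] := s_small _ e4.
  exists N' => // l /= /N'P sl.
  rewrite opprD addrA subrr sub0r normrN ger0_norm ?(mulr_ge0 _ (s_ge0 l))//.
  by rewrite mulrC -ler_pdivlMr.
move=> l /ltnW; rewrite geq_max => /andP[nl Nl].
have [P XP Pbest] := best_approximation alpha_gt0 a_ell u (X_fin l).
exists (energy_norm a (u - P)); split; first by exists P.
  by move=> _ [V XV <-]; exact: Pbest.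
have := galerkin_quasi_optimal alpha_gt0 a_ell (X_fin l) (XU l nl) XP (orth l nl)
  (s_ge0 l) (sE l).
have := NP l Nl; have := s_ge0 l; move: (s l) => t t0 t1 qo.
have t1' : 0 < 1 - t by lra.
have E0 : 0 <= energy_norm a (u - P) by exact: sqrtr_ge0.
rewrite -(ler_pM2l t1'); apply: le_trans qo _.
rewrite mulrA ler_wpM2r//.
by nra.
Qed.
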